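(* Let $T$ be an infinite undirected tree which is transient for simple random walk and which has no vertex of degree $2$. Let $T'=(V,E)$ be a bounded subdivision of $T$, and assign i.i.d. Exponential$(1)$ weights $(U_{\vec e})_{\vec e\in\vec E}$ to the oriented edges of $T'$. Then the wired MSA limit in $T'$ exists almost surely.
   Context: For an undirected graph $G=(V,E)$ (locally finite, connected, multiple edges allowed, no self-loops), $\vec E$ denotes the set of oriented edges obtained by giving each edge of $E$ both of its orientations; $\vec e_-$ is the tail and $\vec e_+$ the head of $\vec e$. For a finite such graph and a distinguished vertex $\partial$ (the boundary), a spanning arborescence of $(G,\partial)$ is a set of oriented edges containing no oriented cycle, in which every vertex other than $\partial$ has exactly one outgoing edge and $\partial$ has none. Given nonnegative weights on $\vec E$ drawn i.i.d. from a continuous distribution, the minimal spanning arborescence (MSA) of $(G,\partial)$ is the (a.s. unique) spanning arborescence minimizing the total weight of its edges. For infinite $G$: an exhaustion is a sequence of finite subgraphs $G_1\subset G_2\subset\cdots$ with $\bigcup_i G_i=G$; $G_i^{\mathsf w}$ is obtained from $G$ by identifying all vertices not in $G_i$ into a single vertex $\partial_i$ and erasing self-loops (oriented edges keep their weights); $T_i$ is the MSA of $(G_i^{\mathsf w},\partial_i)$. We say $T_i$ converges a.s. if for every vertex $v$ of $G$, almost surely the outgoing edge from $v$ in $T_i$ is the same for all sufficiently large $i$. If this holds and the limit does not depend (a.s.) on the choice of exhaustion, we say the wired MSA limit exists almost surely. A subdivision of a graph replaces each edge by a path of finite length; it is bounded if there is $M$ such that every such path has length at most $M$. *)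

(* Defs.v *)
From HB Require Import structures.
From mathcomp Require Import all_boot all_order all_algebra.
From mathcomp Require Import all_classical all_reals all_analysis.
Set Implicit Arguments.
Unset Strict Implicit.
Unset Printing Implicit Defensive.
Import Order.TTheory GRing.Theory Num.Theory.
Local Open Scope classical_set_scope.
Local Open Scope ring_scope.

Section Tree.
Variable V : countType.
Variable nb : V -> seq V.

Definition gadj : rel V := fun u v => v \in nb u.

Definition nbrs_ok : Prop :=
  [/\ forall v, uniq (nb v),
      forall u v, (v \in nb u) = (u \in nb v)
    & forall v, v \notin nb v].

Definition connected_graph : Prop :=
  forall u v, exists p : seq V, path gadj u p /\ last u p = v.

Definition acyclic_graph : Prop :=
  ~ exists (u : V) (p : seq V), [/\ path gadj u p, last u p = u, (2 < size p)%N & uniq p].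

Definition is_tree : Prop := [/\ nbrs_ok, connected_graph & acyclic_graph].

Definition infinite_vertices : Prop := forall s : seq V, exists v, v \notin s.

Definition no_degree_two : Prop := forall v, size (nb v) != 2%N.

(* Simple random walk: hit_prob o k x = P_x(first hitting time of o = k). *)
Fixpoint hit_prob (R : realType) (o : V) (k : nat) (x : V) : R :=
  match k with
  | 0 => (x == o)%:R
  | k'.+1 => if x == o then 0
             else (size (nb x))%:R^-1 * \sum_(y <- nb x) hit_prob R o k' y
  end.

(* P_o(the walk started at o returns to o at some time in [1, n]) *)
Definition return_prob_by (R : realType) (o : V) (n : nat) : R :=
  \sum_(k < n) ((size (nb o))%:R^-1 * \sum_(y <- nb o) hit_prob R o k y).

(* transience: the return probability (the increasing limit of the above) is < 1 *)
Definition srw_transient (R : realType) : Prop :=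
  forall o : V, exists c : R, c < 1 /\ forall n, return_prob_by R o n <= c.

(* Subdivision of T: edge {u,v} replaced by a path of length l u v.    *)
(* New vertices: (u, v, i) with pickle u < pickle v, 0 < i < l u v;    *)
(* the path is u, (u,v,1), ..., (u,v,l u v - 1), v.                    *)
Variable l : V -> V -> nat.

Definition subdiv_lengths_bounded (M : nat) : Prop :=
  forall u v, v \in nb u -> [/\ (1 <= l u v)%N, (l u v <= M)%N & l u v = l v u].

Definition subdiv_pred : pred (V * V * nat) := fun p =>
  [&& p.1.2 \in nb p.1.1, (pickle p.1.1 < pickle p.1.2)%N, (0 < p.2)%N
    & (p.2 < l p.1.1 p.1.2)%N].

Definition sdV : Type := (V + {p : V * V * nat | subdiv_pred p})%type.

Definition sd_adj : rel sdV := fun x y =>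
  match x, y with
  | inl u, inl v => (v \in nb u) && (l u v == 1%N)
  | inl u, inr q => let: (a, b, i) := val q in
                    ((u == a) && (i == 1%N)) || ((u == b) && (i.+1 == l a b))
  | inr q, inl u => let: (a, b, i) := val q in
                    ((u == a) && (i == 1%N)) || ((u == b) && (i.+1 == l a b))
  | inr q, inr q' => let: (a, b, i) := val q in let: (c, d, j) := val q' in
                    [&& a == c, b == d & (i == j.+1) || (j == i.+1)]
  end.

End Tree.

Arguments sd_adj {V} nb l.
HB.instance Definition _ (V : countType) (nb : V -> seq V) (l : V -> V -> nat) :=
  Countable.on (sdV nb l).

Section MSA.
Variable W : countType.
Variable adj : rel W.

(* G_K^w : vertices K + {boundary}; None = the boundary vertex.  An   *)
(* oriented edge e of G survives (i.e. is not an erased self-loop) iff *)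
(* one endpoint lies in K; its tail/head in G_K^w are the projections. *)
Definition wired_edge (K : seq W) (e : W * W) : bool :=
  adj e.1 e.2 && ((e.1 \in K) || (e.2 \in K)).
Definition wtail (K : seq W) (e : W * W) : option W :=
  if e.1 \in K then Some e.1 else None.
Definition whead (K : seq W) (e : W * W) : option W :=
  if e.2 \in K then Some e.2 else None.

Definition no_oriented_cycle (K : seq W) (A : seq (W * W)) : Prop :=
  ~ exists c : seq (W * W),
      [/\ c != [::], all (fun e => e \in A) c
        & cycle (fun e f => whead K e == wtail K f) c].

Definition is_spanning_arborescence (K : seq W) (A : seq (W * W)) : Prop :=
  [/\ uniq A, all (wired_edge K) A,
      forall e, e \in A -> wtail K e != None,
      forall v, v \in K -> count (fun e => wtail K e == Some v) A = 1%N
    & no_oriented_cycle K A].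

Definition arbo_weight (R : realType) (w : W * W -> R) (A : seq (W * W)) : R :=
  \sum_(e <- A) w e.

Definition is_MSA (R : realType) (K : seq W) (w : W * W -> R) (A : seq (W * W)) : Prop :=
  is_spanning_arborescence K A /\
  forall B, is_spanning_arborescence K B -> arbo_weight w A <= arbo_weight w B.

Definition exhaustion (K : nat -> seq W) : Prop :=
  (forall i, {subset K i <= K i.+1}) /\ (forall v, exists i, v \in K i).

Definition iid_exp1_weights (R : realType) d (Omega : measurableType d)
    (P : probability Omega R) (U : W * W -> Omega -> R) : Prop :=
  [/\ forall e, adj e.1 e.2 -> measurable_fun setT (U e),
      forall e, adj e.1 e.2 -> forall B : set R, measurable B ->
        P (U e @^-1` B) = exponential_prob 1 B
    & forall s : seq (W * W), uniq s -> all (fun e => adj e.1 e.2) s ->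
        forall B : W * W -> set R, (forall e, measurable (B e)) ->
        P (\big[setI/setT]_(e <- s) (U e @^-1` B e)) =
          (\prod_(e <- s) P (U e @^-1` B e))%E].

Definition wired_MSA_limit_exists (R : realType) d (Omega : measurableType d)
    (P : probability Omega R) (U : W * W -> Omega -> R) : Prop :=
  exists L : Omega -> W -> W * W,
    forall K : nat -> seq W, exhaustion K -> forall v : W,
      {ae P, forall om, exists N, forall i, (N <= i)%N ->
         forall A, is_MSA (K i) (fun e => U e om) A ->
           (L om v).1 = v /\ L om v \in A}.

End MSA.

(* Main.v *)
Require Import Defs.
From HB Require Import structures.
From mathcomp Require Import all_boot all_order all_algebra.
From mathcomp Require Import all_classical all_reals all_analysis.
From mathcomp Require Import measurable_realfun measurable_fun_approximation.
From mathcomp Require Import ring lra zify.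

(* Write the weights of the edges at a vertex [b] entered from [a] as [w(b,a)]
   (turn back) and [w(b,c)] (go on).  In a tree the optimal arborescence is
   governed by the recursion
     X(a,b) = max(0, min_(c <> a) (w(b,c) + X(b,c)) - w(b,a)),
   started from 0 at depth [n]; X increases with [n], hence has a limit, and an
   exchange argument shows that the outgoing edge of [v] in any MSA eventually
   minimizes [w(v,y) + X(v,y)] at the limit.  As [w(v,y)] is independent of the
   rest and has a diffuse law, the minimizer is a.s. unique as soon as the
   minimum is finite.

   Finiteness: the weights being exponential, [x + 1] is harmonic for the walk
   with increments [w(b,c) - w(b,a)] killed above [x], and the second moment
   method along a flow [th] with potential [F] gives, uniformly in [n],
     P(X(par v, v) <= x) >= (x+1)^2 / ((x+1)^2 + A_v),
     A_v = 1 + 2 M F(v) / th(v).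
   Here this is proved by induction on [n], one half-step (adding or subtracting
   an exponential variable) at a time.  The flow is the gradient of the hitting
   probability of the root, interpolated linearly along subdivided edges. *)

Set Implicit Arguments.
Unset Strict Implicit.
Unset Printing Implicit Defensive.
Import Order.TTheory GRing.Theory Num.Theory.
Import numFieldNormedType.Exports.
Local Open Scope classical_set_scope.
Local Open Scope ring_scope.

(** * Rooted trees *)

(** In y^2/(y^2+A) the number y is a mean, A a variance, and A composes like an electrical
    resistance. Adding or subtracting an exponential variable raises A by 1, and its mean 1 accounts
    for the shift between x and x + 1. Independent branches combine in parallel, because (1+k)(1+k')
    >= 1+k+k' for k = t^2/A. Moving one edge towards the root thus costs 2, one unit for the forward
    weight and one for the turn-back weight. The factor 2 M in A_v makes the drop of F along the
    edge, at least th/M, pay exactly this price; the bound on the lengths supplies M, and transience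
    makes the flow out of the root positive. The obstacle is that only lower bounds on
    probabilities, not moments, pass from one depth to the next, and y^2/(y^2+A) has no convenient
    integral against the exponential law. It is therefore replaced by a quadratic in y, fixed before
    integrating and touching it at the target value. The exchange argument compares two different
    depths, one for the edge chosen and one for its competitor. Both sides are controlled by the
    same limit, which is why the limit forgets the exhaustion. *)

Definition rnbr (W : eqType) (o : W) (par : W -> W) (ch : W -> seq W) (x : W) :=
  if x == o then ch x else par x :: ch x.

(** Acyclicity is encoded by [dep], which grows by one from parent to child. Only [o] can have depth
    0, so iterating [par] reaches [o], which encodes connectedness. *)
Record rooted_tree (W : eqType) (adj : rel W) (o : W) (par : W -> W)
    (dep : W -> nat) (ch : W -> seq W) : Prop := RootedTree {
  rt_adj : forall x y, adj x y = (y \in rnbr o par ch x);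
  rt_ch : forall x y, (y \in ch x) = (y != o) && (par y == x);
  rt_uniq : forall x, uniq (ch x);
  rt_dep0 : dep o = 0%N;
  rt_dep : forall x, x != o -> dep x = (dep (par x)).+1 }.

Section RootedTree.
Variables (W : eqType) (adj : rel W) (o : W) (par : W -> W) (dep : W -> nat).
Variable ch : W -> seq W.
Hypothesis rt : rooted_tree adj o par dep ch.
Local Notation nbr := (rnbr o par ch).

Lemma rt_adjE x y :
  adj x y = ((x != o) && (y == par x)) || ((y != o) && (par y == x)).
Proof.
rewrite (rt_adj rt) /rnbr; have [->|_] /= := eqVneq x o; first by rewrite (rt_ch rt).
by rewrite inE (rt_ch rt).
Qed.

Lemma rt_sym x y : adj x y = adj y x.
Proof. by rewrite !rt_adjE orbC (eq_sym y (par x)) (eq_sym x (par y)). Qed.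

Lemma rt_adj_dep x y : adj x y -> (dep y <= dep x)%N -> x != o /\ y = par x.
Proof.
rewrite rt_adjE => /orP[/andP[xo /eqP->//]|/andP[yo /eqP <-]].
by rewrite (rt_dep rt yo) ltnn.
Qed.

Lemma rnbr_uniq x : uniq (nbr x).
Proof.
rewrite /rnbr; case: eqP => [|/eqP xo]; rewrite /= (rt_uniq rt)// andbT (rt_ch rt).
apply/negP => /andP[px /eqP e]; have := rt_dep rt px.
by rewrite e (rt_dep rt xo); lia.
Qed.

Definition anc y z := (dep y <= dep z)%N && (iter (dep z - dep y) par z == y).

Lemma anc_refl z : anc z z.
Proof. by rewrite /anc leqnn subnn /= eqxx. Qed.

Lemma anc_par y z : y != o -> anc y z -> anc (par y) z.
Proof.
move=> yo /andP[le1 /eqP e]; have d := rt_dep rt yo.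
rewrite /anc; have -> : (dep z - dep (par y) = (dep z - dep y).+1)%N by lia.
by rewrite iterS e eqxx andbT; lia.
Qed.

Lemma anc_eq y y' z : dep y = dep y' -> anc y z -> anc y' z -> y = y'.
Proof. by move=> e /andP[_ /eqP <-] /andP[_ /eqP <-]; rewrite e. Qed.

Lemma anc_ch y b c : c \in ch b -> anc y b -> anc y c.
Proof.
rewrite (rt_ch rt) => /andP[co /eqP e] /andP[le1 /eqP e2].
have d := rt_dep rt co; rewrite e in d.
rewrite /anc d; have -> : ((dep b).+1 - dep y = (dep b - dep y).+1)%N by lia.
by rewrite iterSr e e2 eqxx andbT; lia.
Qed.

(** Non-backtracking walks: [p] continues the step from [a] to [b]. Only immediate reversals are
    excluded, a local condition that the recursion for the barriers can check; in a tree it already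
    forces self-avoidance ([nbt_uniq]). *)
Fixpoint nbt a b p :=
  if p is c :: p' then [&& adj b c, c != a & nbt b c p'] else true.

Definition nbtl q := if q is a :: b :: p then adj a b && nbt a b p else true.

Lemma nbt_down a b p : b \in ch a -> nbt a b p ->
  all (fun x => dep a < dep x)%N (b :: p).
Proof.
elim: p a b => [|c p IH] a b; rewrite (rt_ch rt) => /andP[bo /eqP pb].
  by rewrite /= (rt_dep rt bo) pb ltnS leqnn.
move=> /and3P[bc ca np].
have cb : c \in ch b.
  move: bc; rewrite rt_adjE (rt_ch rt) => /orP[/andP[_ /eqP cE]|//].
  by rewrite cE pb eqxx in ca.
have d : (dep a < dep b)%N by rewrite (rt_dep rt bo) pb.
have /= := IH b c cb np; rewrite d /= => /andP[db /allP h].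
rewrite (ltn_trans d db) /=; apply/allP => x /h; exact: ltn_trans.
Qed.

(** After a step down off the ancestral line of [z], a non-backtracking walk can only keep
    descending, and descendants of a non-ancestor are non-ancestors. *)
Lemma nbt_off z x y p : y \in ch x -> ~~ anc y z -> nbt x y p ->
  all (fun u => ~~ anc u z) (y :: p).
Proof.
elim: p x y => [|c p IH] x y yx ny; first by rewrite /= ny.
move=> /and3P[yc cx np]; rewrite [all _ _]/= ny /=; apply: (IH y) => //.
  move: yc yx; rewrite rt_adjE !(rt_ch rt) => /orP[/andP[_ /eqP cE]|//].
  by move=> /andP[_ /eqP e]; rewrite cE e eqxx in cx.
have co : c \in ch y.
  move: yc yx; rewrite rt_adjE !(rt_ch rt) => /orP[/andP[_ /eqP cE]|//].
  by move=> /andP[_ /eqP e]; rewrite cE e eqxx in cx.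
move: co; rewrite (rt_ch rt) => /andP[co /eqP cp].
by apply: contra ny => /(anc_par co); rewrite cp.
Qed.

(** The walk climbs the ancestral line of [z] for a while and, if it ever turns down, does so
    through a sibling of the ancestor it came from. Two ancestors of [z] at the same depth coincide,
    so that sibling is off the line and [nbt_off] takes over. *)
Lemma nbt_up z x p : x != o -> anc x z -> nbt x (par x) p -> z \notin par x :: p.
Proof.
elim: p x => [|c p IH] x xo ax.
  move=> _; rewrite inE; apply/eqP => e; move: (ax); rewrite {1}e /anc (rt_dep rt xo).
  by rewrite ltnn.
move=> /and3P[pc cx np].
have zp : z != par x.
  by apply/eqP => e; move: (ax); rewrite {1}e /anc (rt_dep rt xo) ltnn.
rewrite in_cons negb_or zp /=.
move: (pc); rewrite rt_adjE => /orP[/andP[po /eqP cE]|/andP[co /eqP pcx]].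
  by rewrite cE; apply: IH => //; [exact: anc_par|rewrite -cE].
have nc : ~~ anc c z.
  apply: contra cx => ac; apply/eqP; apply: anc_eq ac ax.
  by rewrite (rt_dep rt xo) (rt_dep rt co) pcx.
have cc : c \in ch (par x) by rewrite (rt_ch rt) co pcx eqxx.
have /allP h := nbt_off cc nc np.
by apply/negP => /h; rewrite anc_refl.
Qed.

Lemma nbt_uniq a b p : adj a b -> nbt a b p -> uniq (a :: b :: p).
Proof.
have anot a' b' p' : adj a' b' -> nbt a' b' p' -> a' \notin b' :: p'.
  rewrite rt_adjE => /orP[/andP[ao /eqP->]|/andP[bo /eqP pb]] np.
    by apply: nbt_up => //; exact: anc_refl.
  have bc : b' \in ch a' by rewrite (rt_ch rt) bo pb eqxx.
  have /allP h := nbt_down bc np.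
  by apply/negP => /h; rewrite ltnn.
elim: p a b => [|c p IH] a b ab np.
  by have := anot _ _ _ ab np; rewrite /= => ->.
rewrite cons_uniq anot //=; move: np => /and3P[bc ca np]; exact: IH.
Qed.

Lemma nbtl_uniq q : nbtl q -> uniq q.
Proof. by case: q => [//|a [//|b p]] /andP[]; exact: nbt_uniq. Qed.

Lemma nbt_sorted a b p : nbt a b p -> path adj b p.
Proof.
by elim: p a b => [//|c p IH] a b /and3P[bc _ /IH h] /=; rewrite bc.
Qed.

Lemma nbtl_sorted q : nbtl q -> sorted adj q.
Proof. by case: q => [//|a [//|b p]] /andP[/= -> /nbt_sorted]. Qed.

Lemma nbtl_rcons s a b c : nbtl (s ++ [:: a; b]) -> adj b c -> c != a ->
  nbtl (s ++ [:: a; b; c]).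
Proof.
move=> + bc ca.
have h x y t : nbt x y (t ++ [:: a; b]) -> nbt x y (t ++ [:: a; b; c]).
  elim: t x y => [|z t IH] x y /=; rewrite ?bc ?ca ?andbT//.
  by move=> /and3P[-> -> /IH].
case: s => [|x [|y s]] /=.
- by rewrite bc ca !andbT.
- by rewrite bc ca !andbT.
- by move=> /andP[-> /h].
Qed.

(** At a vertex of maximal depth on the cycle, successor and predecessor are both its parent, so the
    cycle turns back there. *)
Lemma cycle_two (sg : W -> W) (s : seq W) : s != [::] ->
  (forall x, x \in s -> adj x (sg x)) -> cycle (fun x y => sg x == y) s ->
  exists x, x \in s /\ sg (sg x) = x /\ sg x \in s.
Proof.
move=> s0 sadj cyc.
have [x xs xmax] : exists2 x, x \in s & forall y, y \in s -> (dep y <= dep x)%N.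
  move: s0; clear; elim: s => [//|a s IH] _.
  case: s IH => [_|b s /(_ isT)[x xs xm]].
    by exists a; rewrite ?inE // => y; rewrite inE => /eqP->.
  have [lex|ltx] := leqP (dep a) (dep x).
    exists x; first by rewrite inE xs orbT.
    by move=> y; rewrite inE => /orP[/eqP->//|/xm].
  exists a; first by rewrite inE eqxx.
  move=> y; rewrite inE => /orP[/eqP->//|/xm h]; exact: leq_trans h (ltnW ltx).
have /eqP nx := next_cycle cyc xs.
have /eqP px := prev_cycle cyc xs.
have sx : sg x \in s by rewrite nx mem_next.
have ps : prev s x \in s by rewrite mem_prev.
have [xo sgE] := rt_adj_dep (sadj _ xs) (xmax _ sx).
have pa : adj x (prev s x) by rewrite rt_sym -{2}px sadj.
have [_ prE] := rt_adj_dep pa (xmax _ ps).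
by exists x; split => //; split => //; rewrite sgE -prE px.
Qed.

End RootedTree.

(** * Barriers *)

Section BigMin.
Variable R : realType.
Local Open Scope ereal_scope.

Lemma le_bigmine (I : Type) (r : seq I) (Q : pred I) (F : I -> \bar R) t :
  (forall i, Q i -> t <= F i) -> t <= \big[mine/+oo]_(i <- r | Q i) F i.
Proof.
move=> h; elim/big_ind: _ => //; first exact: leey.
by move=> x y tx ty; rewrite le_min tx ty.
Qed.

Lemma le_bigmine_seq (I : eqType) (r : seq I) (Q : pred I) (F : I -> \bar R) t :
  (forall i, i \in r -> Q i -> t <= F i) ->
  t <= \big[mine/+oo]_(i <- r | Q i) F i.
Proof.
by move=> h; rewrite big_seq_cond; apply: le_bigmine => i /andP[]; exact: h.
Qed.

Lemma bigmine_le (I : eqType) (r : seq I) (Q : pred I) (F : I -> \bar R) i :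
  i \in r -> Q i -> \big[mine/+oo]_(i <- r | Q i) F i <= F i.
Proof.
elim: r => [//|a r IH]; rewrite inE big_cons => /orP[/eqP<- ->|ir Qi].
  by rewrite ge_min lexx.
by case: ifP => _; [rewrite ge_min IH ?orbT|exact: IH].
Qed.

Lemma bigmine_leP (I : eqType) (r : seq I) (Q : pred I) (F : I -> \bar R) t :
  t < +oo -> \big[mine/+oo]_(i <- r | Q i) F i <= t ->
  exists i, [/\ i \in r, Q i & F i <= t].
Proof.
move=> toy; elim: r => [|a r IH]; first by rewrite big_nil leNgt toy.
rewrite big_cons; case: ifP => Qa.
  rewrite ge_min => /orP[h|/IH[i [ir Qi Fi]]]; first by exists a; rewrite inE eqxx.
  by exists i; rewrite inE ir orbT.
by move=> /IH[i [ir Qi Fi]]; exists i; rewrite inE ir orbT.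
Qed.

End BigMin.

Section Barrier.
Variables (W : eqType) (nbr : W -> seq W) (R : realType) (w : W * W -> R).

Local Open Scope ereal_scope.

(** The price of forbidding [b] to point back at [a]: the difference between the optimal weights of
    the branch behind [b] with and without this constraint. Depth 0 stands for the boundary, where
    there is nothing to pay. At a dead end the empty minimum is [+oo]: forbidding the edge back
    leaves no way out. *)
Fixpoint barrier (n : nat) (a b : W) : \bar R :=
  if n is n'.+1 then
    maxe 0 (\big[mine/+oo]_(c <- nbr b | c != a)
              ((w (b, c))%:E + barrier n' b c) - (w (b, a))%:E)
  else 0.

Lemma barrierS n a b : barrier n.+1 a b =
  maxe 0 (\big[mine/+oo]_(c <- nbr b | c != a)
            ((w (b, c))%:E + barrier n b c) - (w (b, a))%:E).
Proof. by []. Qed.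

Lemma barrier_ge0 n a b : 0 <= barrier n a b.
Proof. by case: n => [//|n] /=; rewrite le_max lexx. Qed.

Lemma barrier_leS n a b : barrier n a b <= barrier n.+1 a b.
Proof.
elim: n a b => [|n IH] a b; first exact: barrier_ge0.
rewrite /=; apply: le_max2 => //; apply: leeD2r.
apply: le_bigmine_seq => c cb ca; apply: le_trans (bigmine_le _ cb ca) _.
by rewrite leeD2l// IH.
Qed.

Lemma barrier_mono m n a b : (m <= n)%N -> barrier m a b <= barrier n a b.
Proof.
move=> /subnKC <-; elim: (n - m)%N => [|k IH]; first by rewrite addn0.
by rewrite addnS; apply: le_trans IH (barrier_leS _ _ _).
Qed.

Definition barrier_lim a b := ereal_sup (range (fun n => barrier n a b)).

Lemma barrier_le_lim n a b : barrier n a b <= barrier_lim a b.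
Proof. by apply: ereal_sup_ubound; exists n. Qed.

Lemma barrier_lim_ge0 a b : 0 <= barrier_lim a b.
Proof. exact: le_trans (barrier_ge0 0 a b) (barrier_le_lim 0 a b). Qed.

Lemma barrier_lim_le a b t : (forall n, barrier n a b <= t) -> barrier_lim a b <= t.
Proof. by move=> h; apply: ge_ereal_sup => _ [n _ <-]. Qed.

(* Pigeonhole: one branch works for all [n] because the barriers increase with [n]. *)
Lemma bigmin_barrier_lim a (Q : pred W) t : t < +oo ->
  (forall n, \big[mine/+oo]_(c <- nbr a | Q c) ((w (a, c))%:E + barrier n a c) <= t) ->
  exists c, [/\ c \in nbr a, Q c & (w (a, c))%:E + barrier_lim a c <= t].
Proof.
move=> toy h; apply: contrapT => /forallNP no.
have bad c : c \in nbr a -> Q c -> exists n, t < (w (a, c))%:E + barrier n a c.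
  move=> ca Qc; apply: contrapT => /forallNP hn; apply: (no c); split => //.
  rewrite addeC -leeBrDr//; apply: barrier_lim_le => n.
  by rewrite leeBrDr// addeC leNgt; apply/negP/hn.
have [N HN] : exists N, forall c, c \in nbr a -> Q c ->
    t < (w (a, c))%:E + barrier N a c.
  elim: (nbr a) bad => [_|c r IH bad]; first by exists 0%N.
  have [N1 H1] : exists N, forall c, c \in r -> Q c -> t < (w (a, c))%:E + barrier N a c.
    by apply: IH => d dr; apply: bad; rewrite inE dr orbT.
  have [Qc|nQc] := boolP (Q c); last first.
    exists N1 => d; rewrite inE => /orP[/eqP->|]; last exact: H1.
    by rewrite (negbTE nQc).
  have [N2 H2] := bad c (mem_head _ _) Qc.
  exists (maxn N1 N2) => d; rewrite inE => /orP[/eqP->|dr] Qd.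
    by apply: lt_le_trans H2 _; rewrite leeD2l// barrier_mono// leq_maxr.
  by apply: lt_le_trans (H1 d dr Qd) _; rewrite leeD2l// barrier_mono// leq_maxl.
have [c [ca Qc]] := bigmine_leP toy (h N).
by apply/negP; rewrite -ltNge; exact: HN.
Qed.

Definition has_exit a := exists2 c, c \in nbr a & barrier_lim a c < +oo.

(** If the exit of [a] avoids [b], then [b] leaves through [a]. Otherwise [a] exits through [b], and
    finiteness of that barrier bounds the onward costs of [b] at all depths, so the pigeonhole lemma
    yields an exit of [b] other than [a]. *)
Lemma has_exit_adj a b : b \in nbr a -> a \in nbr b -> has_exit a -> has_exit b.
Proof.
move=> ba ab [c ca cfin].
have cge := barrier_lim_ge0 a c.
have [C CE] : exists C : R, barrier_lim a c = C%:E.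
  by move: cfin cge; case: (barrier_lim a c) => // r _ _; exists r.
have [bc|cb] := eqVneq b c; last first.
  exists a => //.
  apply: (@le_lt_trans _ _ (maxe 0 ((w (a, c) + C - w (a, b))%:E))); last first.
    by rewrite gt_max ltry/= ltry.
  apply: barrier_lim_le => -[|n] /=; first by rewrite le_max lexx.
  apply: le_max2 => //; rewrite EFinB; apply: leeD2r.
  apply: le_trans (bigmine_le _ ca _) _; first by rewrite eq_sym.
  by rewrite EFinD leeD2l// -CE barrier_le_lim.
subst c.
have [] := @bigmin_barrier_lim b (fun c => c != a) (C + w (b, a))%:E; first exact: ltry.
  move=> n; have := barrier_le_lim n.+1 a b; rewrite CE barrierS ge_max => /andP[_].
  by rewrite leeBlDr// EFinD.
move=> d [db _ h]; exists d => //.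
rewrite ltNge leye_eq; apply/negP => /eqP e.
by move: h; rewrite e addey.
Qed.

Fixpoint nball (n : nat) (v : W) : seq W :=
  if n is n'.+1 then v :: flatten [seq nball n' y | y <- nbr v] else [:: v].

Lemma nball_refl n v : v \in nball n v.
Proof. by case: n => [|n] /=; rewrite inE eqxx. Qed.

Lemma nball_step n v y : y \in nbr v -> {subset nball n y <= nball n.+1 v}.
Proof.
move=> yv z zy /=; rewrite inE; apply/orP; right; apply/flattenP.
by exists (nball n y) => //; apply/mapP; exists y.
Qed.

End Barrier.

(** * Minimal arborescences of wired trees *)

Section Arborescence.
Variables (W : countType) (adj : rel W) (o : W) (par : W -> W) (dep : W -> nat).
Variable ch : W -> seq W.
Hypothesis rt : rooted_tree adj o par dep ch.
Local Notation nbr := (rnbr o par ch).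
Variable K : seq W.

(* In a tree, a functional digraph is acyclic as soon as it has no 2-cycle. *)
Definition admissible (sg : W -> W) : Prop :=
  (forall x, x \in K -> adj x (sg x)) /\
  (forall x, x \in K -> sg x \in K -> sg (sg x) != x).

Definition out_edges (sg : W -> W) := [seq (x, sg x) | x <- undup K].

Lemma wtail_in x y : x \in K -> wtail K (x, y) = Some x.
Proof. by rewrite /wtail /= => ->. Qed.

Lemma whead_in x y : y \in K -> whead K (x, y) = Some y.
Proof. by rewrite /whead /= => ->. Qed.

Lemma spanning_admissible A : is_spanning_arborescence adj K A ->
  exists2 sg, admissible sg & perm_eq A (out_edges sg).
Proof.
case=> uA /allP wA tA cA nA.
have eK e : e \in A -> e.1 \in K.
  by move=> /tA; rewrite /wtail; case: (e.1 \in K).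
have ex x : x \in K -> exists y, (x, y) \in A.
  move=> xK; have : has (fun e => wtail K e == Some x) A by rewrite has_count cA.
  case/hasP => -[x' y] eA; rewrite wtail_in ?(eK _ eA)// => /eqP[<-].
  by exists y.
have uniqA x y y' : (x, y) \in A -> (x, y') \in A -> y = y'.
  move=> h h'; apply: contrapT => ne; have := cA x (eK _ h).
  rewrite -size_filter => s1.
  have : (size [:: (x, y); (x, y')] <= size [seq e <- A | wtail K e == Some x])%N.
    apply: uniq_leq_size.
      by rewrite /= andbT inE; apply/eqP => -[].
    move=> e; rewrite !inE mem_filter => /orP[]/eqP->.
      by rewrite h wtail_in ?(eK _ h)//= eqxx.
    by rewrite h' wtail_in ?(eK _ h)//= eqxx.
  by rewrite s1.
pose sg x := if pselect (exists y, (x, y) \in A) is left p then projT1 (cid p) else x.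
have sgA x : x \in K -> (x, sg x) \in A.
  move=> xK; rewrite /sg; case: pselect => [p|]; first exact: (projT2 (cid p)).
  by move=> /(_ (ex _ xK)).
exists sg; first split.
- by move=> x /sgA /wA /andP[].
- move=> x xK sK; apply/eqP => e; apply: nA.
  exists [:: (x, sg x); (sg x, sg (sg x))]; split => //.
    by rewrite /= !sgA.
  by rewrite /= e !wtail_in ?whead_in ?eqxx//.
apply: uniq_perm => //.
  rewrite map_inj_uniq ?undup_uniq//; by move=> x y [].
move=> [x y]; apply/idP/mapP => [h|[z]].
  have xK := eK _ h; exists x; first by rewrite mem_undup.
  by rewrite (uniqA _ _ _ h (sgA _ xK)).
by rewrite mem_undup => zK [-> ->]; exact: sgA.
Qed.

(** Every listed edge has its tail in [K], so an oriented cycle cannot pass through the boundary.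
    Its tails form a cycle of [sg], and [cycle_two] finds a 2-cycle in it. *)
Lemma admissible_spanning sg : admissible sg ->
  is_spanning_arborescence adj K (out_edges sg).
Proof.
case=> sadj s2.
have mem e : e \in out_edges sg -> e.1 \in K /\ e.2 = sg e.1.
  by move=> /mapP[x]; rewrite mem_undup => xK ->.
split.
- rewrite map_inj_uniq ?undup_uniq//; by move=> x y [].
- by apply/allP => e /mem[eK e2]; rewrite /wired_edge e2 sadj// eK.
- by move=> e /mem[eK _]; rewrite /wtail eK.
- move=> v vK; rewrite count_map.
  rewrite (@eq_in_count _ _ (pred1 v)) ?count_uniq_mem ?undup_uniq ?mem_undup ?vK//.
  move=> x; rewrite mem_undup => xK /=; rewrite wtail_in//.
- case=> c [c0 /allP cA cyc].
  have memc e : e \in c -> e.1 \in K /\ e.2 = sg e.1 by move/cA/mem.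
  have cyc' : cycle (fun x y => sg x == y) (map fst c).
    rewrite cycle_map; have sub : {in c &, subrel (fun e f => whead K e == wtail K f)
                 (relpre fst (fun x y => sg x == y))}; last first.
      by apply: (sub_in_cycle sub _ cyc); exact/allP.
    move=> e f /= ec fc; have [eK e2] := memc _ ec; have [fK _] := memc _ fc.
    rewrite /whead /wtail fK e2 /=; case: ifP => // _ /eqP[->]; exact: eqxx.
  have cK x : x \in map fst c -> x \in K by move=> /mapP[e /memc[eK _] ->].
  have [||x [xc [sx sc]]] := @cycle_two _ _ _ _ _ _ rt sg (map fst c) _ _ cyc'.
  + by case: (c) c0.
  + by move=> x /cK; exact: sadj.
  by move: (s2 x (cK _ xc) (cK _ sc)); rewrite sx eqxx.
Qed.

(** * Exchange argument along non-backtracking walks *)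

Variables (R : realType) (w : W * W -> R).

Lemma arbo_weight_out_edges sg :
  arbo_weight w (out_edges sg) = \sum_(x <- undup K) w (x, sg x).
Proof. by rewrite /arbo_weight big_map. Qed.

Definition optimal (sg : W -> W) := admissible sg /\
  forall tau, admissible tau ->
    \sum_(x <- undup K) w (x, sg x) <= \sum_(x <- undup K) w (x, tau x).

Lemma MSA_optimal A : is_MSA adj K w A ->
  exists2 sg, optimal sg & perm_eq A (out_edges sg).
Proof.
case=> /spanning_admissible[sg sgP pA] min; exists sg => //; split=> // tau tP.
rewrite -!arbo_weight_out_edges; have := min _ (admissible_spanning tP).
by rewrite {1}/arbo_weight (perm_big _ pA).
Qed.

Variable sg : W -> W.
Hypothesis sg_opt : optimal sg.

Let sg_adj x : x \in K -> adj x (sg x). Proof. by case: sg_opt.1 => + _; exact. Qed.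
Let sg_two x : x \in K -> sg x \in K -> sg (sg x) != x.
Proof. by case: sg_opt.1 => _; exact. Qed.

(** The exchange move: each vertex of the walk [q] except the last is made to point at the next one.
    [detour q] below is the resulting change of total weight, as [sum_redirect] shows. *)
Fixpoint redirect (q : seq W) (x : W) : W :=
  if q is z :: q' then
    if q' is z1 :: _ then (if x == z then z1 else redirect q' x) else sg x
  else sg x.

Fixpoint detour (q : seq W) : R :=
  if q is z :: q' then
    if q' is z1 :: _ then w (z, z1) - w (z, sg z) + detour q' else 0
  else 0.

Lemma redirect_notin q x : x \notin q -> redirect q x = sg x.
Proof.
elim: q => [//|z [//|z1 q] IH]; rewrite in_cons negb_or => /andP[xz xq].
by rewrite /= (negbTE xz); exact: IH.
Qed.

(** A 2-cycle can only arise at the end of the walk, between [a] and [b], and the last hypothesis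
    excludes it there. Earlier on the walk a redirected vertex points forward to one that also
    points forward, and the walk does not repeat vertices. *)
Lemma redirect_admissible s a b :
  uniq (s ++ [:: a; b]) -> sorted adj (s ++ [:: a; b]) ->
  all (mem K) (s ++ [:: a]) -> (b \notin K) || (sg b != a) ->
  admissible (redirect (s ++ [:: a; b])).
Proof.
elim: s => [|z s IH].
  move=> /=; rewrite inE !andbT => ab adjab aK bc; split.
    by move=> x xK; case: eqP => [->//|_]; exact: sg_adj.
  move=> x xK; have [->|xa] := eqVneq x a.
    by move=> bK; rewrite (eq_sym b) (negbTE ab); move: bc; rewrite bK.
  have [sxa _|_] := eqVneq (sg x) a; last exact: sg_two.
  by apply/eqP => e; move: bc; rewrite e xK sxa eqxx.
have [z1 [t E]] : exists z1 t, s ++ [:: a; b] = z1 :: t.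
  by case: (s) => [|z1 t]; eexists; eexists.
rewrite !cat_cons => /andP[zu us] srt /andP[zK aK] bc.
have szt : adj z z1 by move: srt; rewrite E => /andP[].
have [IH1 IH2] := IH us (path_sorted srt) aK bc.
have rz1 : redirect (s ++ [:: a; b]) z1 != z.
  rewrite E; move: E zu us bc; case: t => [|z2 t].
    by case: (s) => [|? [|? ?]].
  move=> -> /=; rewrite eqxx !in_cons !negb_or => /and3P[_ + _] _ _.
  by rewrite eq_sym.
have stepE x : redirect (z :: (s ++ [:: a; b])) x =
    if x == z then z1 else redirect (s ++ [:: a; b]) x by rewrite E.
rewrite [redirect _](_ : _ =
    fun x => if x == z then z1 else redirect (s ++ [:: a; b]) x); last first.
  by apply: funext => x; exact: stepE.
split=> x xK.
  by case: eqP => [->//|_]; exact: IH1.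
have [->|xz] := eqVneq x z.
  move=> z1K; have [e|_//] := eqVneq z1 z.
  by move: zu; rewrite E -e inE eqxx.
have [rx _|_] := eqVneq (redirect (s ++ [:: a; b]) x) z; last exact: IH2.
by apply: contra rz1 => /eqP->; rewrite rx.
Qed.

Lemma sum_redirect s a b : uniq (s ++ [:: a; b]) -> all (mem K) (s ++ [:: a]) ->
  \sum_(x <- undup K) w (x, redirect (s ++ [:: a; b]) x) =
  \sum_(x <- undup K) w (x, sg x) + detour (s ++ [:: a; b]).
Proof.
have step z z1 (f : W -> W) : z \in K -> f z = sg z ->
  \sum_(x <- undup K) w (x, if x == z then z1 else f x) =
  \sum_(x <- undup K) w (x, f x) + (w (z, z1) - w (z, sg z)).
  move=> zK fz; rewrite (bigD1_seq z) ?mem_undup ?undup_uniq//= eqxx.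
  rewrite [in RHS](bigD1_seq z) ?mem_undup ?undup_uniq//= fz.
  rewrite (eq_bigr (fun x => w (x, f x))); first by ring.
  by move=> x /negbTE ->.
elim: s => [|z s IH].
  by move=> /= _ /andP[aK _]; rewrite step// addr0.
have [z1 [t E]] : exists z1 t, s ++ [:: a; b] = z1 :: t.
  by case: (s) => [|z1 t]; eexists; eexists.
rewrite !cat_cons => /andP[zu us] /andP[zK aK].
have := IH us aK; rewrite E /= => h.
rewrite step//; last by apply: (@redirect_notin (z1 :: t)); rewrite -E.
by rewrite h; ring.
Qed.

Lemma detour_ge0 s a b :
  uniq (s ++ [:: a; b]) -> sorted adj (s ++ [:: a; b]) ->
  all (mem K) (s ++ [:: a]) -> (b \notin K) || (sg b != a) ->
  0 <= detour (s ++ [:: a; b]).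
Proof.
move=> u srt aK bc; have := sg_opt.2 _ (redirect_admissible u srt aK bc).
by rewrite sum_redirect// lerDl.
Qed.

Lemma detour_rcons s a b c :
  detour (s ++ [:: a; b; c]) = detour (s ++ [:: a; b]) + (w (b, c) - w (b, sg b)).
Proof.
elim: s => [|z s IH]; first by rewrite /=; ring.
case: s IH => [|z1 s] IH; first by rewrite /=; ring.
by rewrite !cat_cons /= in IH *; rewrite IH; ring.
Qed.

Local Notation nbtl := (nbtl adj).
Local Notation barrier := (barrier nbr w).
Local Open Scope ereal_scope.

(** If the walk may end at [b], optimality makes the detour alone nonnegative. Otherwise [sg b] is
    [a], and prolonging the walk to [c] changes the detour by w(b,c) - w(b,a), which is one step of
    the barrier recursion. For [N = 0] the self-avoiding walk has more vertices than [K], so its end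
    has left [K]. *)
Lemma detour_barrier_ge0 N s a b : nbtl (s ++ [:: a; b]) ->
  all (mem K) (s ++ [:: a]) -> (size K < (size s).+2 + N)%N ->
  0 <= (detour (s ++ [:: a; b]))%:E + barrier N a b.
Proof.
elim: N s a b => [|N IH] s a b nb aK sz.
  rewrite addr0 lee_fin; apply: detour_ge0 => //; first exact: (nbtl_uniq rt nb).
    exact: (nbtl_sorted nb).
  apply/orP; left; apply/negP => bK.
  move: sz; rewrite addn0 ltnNge => /negP; apply.
  have <- : size (s ++ [:: a; b]) = (size s).+2 by rewrite size_cat addn2.
  apply: uniq_leq_size; first exact: (nbtl_uniq rt nb).
  move: aK; rewrite all_cat => /andP[/allP sK /andP[/= aK _]] x.
  by rewrite mem_cat !inE => /or3P[/sK//|/eqP->//|/eqP->].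
have [bc|] := boolP ((b \notin K) || (sg b != a)).
  apply: adde_ge0; last exact: barrier_ge0.
  rewrite lee_fin; apply: detour_ge0 => //; first exact: (nbtl_uniq rt nb).
  exact: (nbtl_sorted nb).
rewrite negb_or !negbK => /andP[bK /eqP sba].
set m := \big[mine/+oo]_(c <- nbr b | c != a) ((w (b, c))%:E + barrier N b c).
have : (w (b, a) - detour (s ++ [:: a; b]))%:E <= m.
  apply: le_bigmine_seq => c cb ca.
  have bcadj : adj b c by rewrite (rt_adj rt).
  have := IH (s ++ [:: a]) b c.
  rewrite -!catA /= detour_rcons sba size_cat addn1 addSnnS => /(_ _ _ _) h.
  have {h} : 0 <= (detour (s ++ [:: a; b]) + (w (b, c) - w (b, a)))%:E + barrier N b c.
    apply: h => //; first exact: nbtl_rcons.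
    by rewrite -cat1s catA all_cat aK /= bK.
  case: (barrier N b c) => [r| |]; [|by move=> _; rewrite addey// leey|by []].
  by rewrite -!EFinD !lee_fin; lra.
rewrite barrierS -/m; case: m => [r| |].
- rewrite lee_fin => h; apply: (@le_trans _ _ ((detour (s ++ [:: a; b]))%:E +
    (r%:E - (w (b, a))%:E))); last by rewrite leeD2l// le_max lexx orbT.
  by rewrite -EFinB -EFinD lee_fin; lra.
- by move=> _; rewrite addye// maxey addey.
- by rewrite leeNy_eq.
Qed.

(** The orbit of [sg] from [v] is reversed one edge at a time: [sg a] is put in front of the walk,
    and [sg (sg a)] is the competitor tested in the minimum that defines the barrier. The second
    hypothesis handles the comparison with 0 in the [maxe]. *)
Lemma optimal_argmin_aux v y : v \in K ->
  (forall s, nbtl (s ++ [:: v; y]) -> all (mem K) (s ++ [:: v]) ->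
    0 <= (detour (s ++ [:: v; y]))%:E + barrier (size K) v y) ->
  forall n s a b' p, s ++ [:: v; y] = [:: a, b' & p] ->
    nbtl (s ++ [:: v; y]) -> all (mem K) (s ++ [:: v]) ->
    sg a != b' -> {subset nball nbr n a <= K} ->
    barrier n a (sg a) <= (detour (s ++ [:: v; y]))%:E + barrier (size K) v y.
Proof.
move=> vK H; elim=> [|n IH] s a b' p E nb sK sab ball; first exact: H.
have aK : a \in K by apply: ball; exact: nball_refl.
have an : sg a \in nbr a by rewrite -(rt_adj rt) sg_adj.
have bK : sg a \in K by apply: ball; apply: nball_step an _ _; exact: nball_refl.
have := IH (sg a :: s) (sg a) a (b' :: p).
rewrite !cat_cons E => /(_ erefl) h.
have {h} : barrier n (sg a) (sg (sg a)) <=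
    (w (sg a, a) - w (sg a, sg (sg a)) + detour [:: a, b' & p])%:E
      + barrier (size K) v y.
  apply: h => //.
  - move: nb; rewrite E /= => /andP[-> ->].
    by rewrite (rt_sym rt) sg_adj// eq_sym sab.
  - by rewrite /= bK sK.
  - exact: sg_two.
  - by move=> x xb; apply: ball; apply: nball_step an _ xb.
have : 0 <= barrier n (sg a) (sg (sg a)) by exact: barrier_ge0.
have := H s nb sK; rewrite E barrierS => H0 h0 h1.
rewrite ge_max H0 andTb.
have sadj : sg (sg a) \in nbr (sg a) by rewrite -(rt_adj rt) sg_adj.
have := bigmine_le (fun c => (w (sg a, c))%:E + barrier n (sg a) c) sadj
  (sg_two aK bK : (fun c => c != a) (sg (sg a))).
move: h1 h0; case: (barrier n (sg a) (sg (sg a))) => [r| |] //; last first.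
  rewrite leye_eq => /eqP.
  by case: (barrier (size K) v y) => [r'| |]//; rewrite ?addey ?leey.
case: (barrier (size K) v y) => [r'| |].
- rewrite -!EFinD !lee_fin => h1 h0 hm.
  by rewrite leeBlDr//; apply: le_trans hm _; rewrite -EFinD lee_fin; lra.
- by move=> _ _ _; rewrite addey// leey.
- by [].
Qed.

(** The chosen edge is measured at depth [n], the radius of a ball inside [K]; its competitor at
    depth [size K], which no self-avoiding walk inside [K] exceeds. The second depth may be replaced
    by the limit, since barriers increase. *)
Lemma optimal_argmin n v y : v \in K -> y \in nbr v -> y != sg v ->
  {subset nball nbr n v <= K} ->
  (w (v, sg v))%:E + barrier n v (sg v) <= (w (v, y))%:E + barrier (size K) v y.
Proof.
move=> vK yv yn ball.
have vy : adj v y by rewrite (rt_adj rt).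
have := @optimal_argmin_aux v y vK _ n [::] v y [::] erefl.
rewrite /= vy vK eq_sym yn /= addr0 => /(_ _ isT isT isT ball) h.
have {h} : barrier n v (sg v) <= (w (v, y) - w (v, sg v))%:E + barrier (size K) v y.
  apply: h => s nb sK; apply: detour_barrier_ge0 => //.
  by rewrite addSn addSn ltnS (leq_trans _ (leqnSn _))// leq_addl.
case: (barrier (size K) v y) => [r| |].
- case: (barrier n v (sg v)) => [r'| |]; [| |by move=> _; rewrite addeNy leNye].
    2: by rewrite -EFinD leye_eq.
  by rewrite -!EFinD !lee_fin; lra.
- by move=> _; rewrite addey// leey.
- by rewrite addeNy leeNy_eq => /eqP->.
Qed.

End Arborescence.

(** * Stabilization of the outgoing edge along an exhaustion *)

Section Argmin.
Variables (W : countType) (adj : rel W) (o : W) (par : W -> W) (dep : W -> nat).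
Variable ch : W -> seq W.
Hypothesis rt : rooted_tree adj o par dep ch.
Local Notation nbr := (rnbr o par ch).
Variables (R : realType) (w : W * W -> R).
Local Open Scope ereal_scope.

Definition exit_cost v y := (w (v, y))%:E + barrier_lim nbr w v y.

Definition strict_argmin v y := y \in nbr v /\
  forall z, z \in nbr v -> z != y -> exit_cost v y < exit_cost v z.

Lemma strict_argmin_exists v : has_exit nbr w v ->
  (forall y z, y \in nbr v -> z \in nbr v -> y != z ->
     exit_cost v y < +oo -> exit_cost v y != exit_cost v z) ->
  exists y, strict_argmin v y.
Proof.
move=> [c cv cfin] ties.
have [y yv ymin] : exists2 y, y \in nbr v &
    forall z, z \in nbr v -> exit_cost v y <= exit_cost v z.
  elim: (nbr v) c cv {cfin ties} => [//|a r IH] c _.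
  case: r IH => [_|b r IH].
    by exists a; rewrite ?inE// => z; rewrite inE => /eqP->.
  have [y yr ymin] := IH b (mem_head _ _).
  have [le1|lt1] := leP (exit_cost v a) (exit_cost v y).
    exists a; first by rewrite inE eqxx.
    by move=> z; rewrite inE => /orP[/eqP->//|/ymin]; exact: le_trans.
  exists y; first by rewrite inE yr orbT.
  by move=> z; rewrite inE => /orP[/eqP->|/ymin//]; exact: ltW.
exists y; split=> // z zv zy; rewrite lt_neqAle ymin// andbT.
apply: ties => //; first by rewrite eq_sym.
by apply: le_lt_trans (ymin c cv) _; rewrite /exit_cost lte_add_pinfty// ltry.
Qed.

Lemma exhaustion_sub (K : nat -> seq W) (s : seq W) : exhaustion K ->
  exists N, forall i, (N <= i)%N -> {subset s <= K i}.
Proof.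
case=> Kinc Kall.
have mono i j : (i <= j)%N -> {subset K i <= K j}.
  move=> /subnKC <-; elim: (j - i)%N => [|k IH] x; first by rewrite addn0.
  by move=> /IH; rewrite addnS; exact: Kinc.
elim: s => [|x s [N HN]]; first by exists 0%N.
have [M xM] := Kall x; exists (maxn M N) => i; rewrite geq_max => /andP[Mi Ni] z.
by rewrite inE => /orP[/eqP->|/HN]; [exact: mono xM|exact].
Qed.

(** The strict inequalities at the limit already hold at one finite depth [n] for all of the
    finitely many competitors. Once [K i] contains the ball of radius [n], choosing another edge
    would contradict [optimal_argmin]. *)
Lemma MSA_strict_argmin v y (K : nat -> seq W) : strict_argmin v y ->
  exhaustion K ->
  exists N, forall i, (N <= i)%N -> forall A, is_MSA adj (K i) w A -> (v, y) \in A.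
Proof.
move=> [yv ymin] exK.
have [n Hn] : exists n, forall z, z \in nbr v -> z != y ->
    exit_cost v y < (w (v, z))%:E + barrier nbr w n v z.
  elim: (nbr v) ymin => [_|z r IH ymin]; first by exists 0%N.
  have [n1 H1] := IH (fun z zr => ymin z (@mem_behead _ (_ :: _) _ zr)).
  have [->|zy] := eqVneq z y.
    by exists n1 => u; rewrite inE => /orP[/eqP->|/H1//]; rewrite eqxx.
  have [n2 H2] : exists n, exit_cost v y < (w (v, z))%:E + barrier nbr w n v z.
    apply: contrapT => /forallNP no.
    have := ymin z (mem_head _ _) zy; rewrite ltNge => /negP; apply.
    rewrite {1}/exit_cost addeC -leeBrDr//; apply: barrier_lim_le => k.
    by rewrite leeBrDr// addeC leNgt; apply/negP/no.
  exists (maxn n1 n2) => u; rewrite inE => /orP[/eqP-> _|/H1 h /h {}h].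
    by apply: lt_le_trans H2 _; rewrite leeD2l// barrier_mono// leq_maxr.
  by apply: lt_le_trans h _; rewrite leeD2l// barrier_mono// leq_maxl.
have [N HN] := exhaustion_sub (nball nbr n v) exK.
exists N => i Ni A /(MSA_optimal rt)[sg opt pA].
have vK : v \in K i by apply: (HN _ Ni); exact: nball_refl.
have [sy|sy] := eqVneq y (sg v).
  by rewrite (perm_mem pA) sy; apply/mapP; exists v; rewrite // mem_undup.
have sv : sg v \in nbr v by rewrite -(rt_adj rt); case: opt => -[+ _] _; exact.
have := optimal_argmin rt opt vK yv sy (HN i Ni).
rewrite leNgt => /negP; case; apply: le_lt_trans _ (Hn _ sv _); last by rewrite eq_sym.
by rewrite leeD2l// barrier_le_lim.
Qed.

End Argmin.

(** * Independence and the exponential law *)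

Section Independence.
Context (R : realType) d (Omega : measurableType d) (P : probability Omega R).

Definition indep_sets (G1 G2 : set (set Omega)) : Prop :=
  forall A B, G1 A -> G2 B -> P (A `&` B) = (P A * P B)%E.

Lemma indep_setsC G1 G2 : indep_sets G1 G2 -> indep_sets G2 G1.
Proof. by move=> h A B GA GB; rewrite setIC muleC h. Qed.

(** Dynkin's argument: for a fixed [B], the events independent of [B] form a lambda-system. *)
Lemma indep_sets_sigma (G1 G2 : set (set Omega)) :
  setI_closed G1 -> G1 `<=` measurable -> G2 `<=` measurable ->
  indep_sets G1 G2 -> indep_sets <<s G1 >> G2.
Proof.
move=> GI G1m G2m ind A B GA GB.
have mB := G2m _ GB.
have sub : <<s G1 >> `<=` measurable.
  by apply: smallest_sub => //; exact: sigma_algebra_measurable.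
suff : <<s G1 >> `<=` [set A | measurable A /\ P (A `&` B) = (P A * P B)%E].
  by move=> /(_ _ GA)[].
apply: lambda_system_subset => //.
- split => //.
  + by split => //; rewrite setTI probability_setT mul1e.
  + move=> X Y YX [mX iX] [mY iY]; split; first exact: measurableD.
    have fX : P X \is a fin_num by exact: fin_num_measure.
    have fY : P Y \is a fin_num by exact: fin_num_measure.
    have mXB : measurable (X `&` B) by exact: measurableI.
    have mYB : measurable (Y `&` B) by exact: measurableI.
    have oXB : (P (X `&` B) < +oo)%E by rewrite -ge0_fin_numE// fin_num_measure.
    have -> : (X `\` Y) `&` B = (X `&` B) `\` (Y `&` B).
      apply/seteqP; split => [x [[Xx nYx] Bx]|x [[Xx Bx] nYB]].
        by split => // -[].
      by split => //; split => // Yx; apply: nYB.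
    rewrite measureD// (_ : X `&` B `&` (Y `&` B) = Y `&` B); last first.
      by apply/seteqP; split => [x []|x [Yx Bx]]//=; split => //; split => //; exact: YX.
    have oX : (P X < +oo)%E by rewrite -ge0_fin_numE.
    have -> : P (X `\` Y) = (P X - P Y)%E by rewrite measureD// (setIidr YX).
        transitivity (P X * P B - P Y * P B)%E; first by congr (_ - _)%E.
    have fB : P B \is a fin_num by exact: fin_num_measure.
    by rewrite muleBl// fin_num_adde_defr.
  + move=> F ndF HF.
    have mF n : measurable (F n) by have [] := HF n.
    split; first exact: bigcup_measurable.
    have mFB n : measurable (F n `&` B) by exact: measurableI.
    have ndFB : nondecreasing_seq (fun n => F n `&` B).
      by move=> m n mn; apply/subsetPset; apply: setSI; exact/subsetPset/ndF.
    have c1 := nondecreasing_cvg_mu (mu := P) mF (bigcup_measurable (fun n _ => mF n)) ndF.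
    have c2 := nondecreasing_cvg_mu (mu := P) mFB (bigcup_measurable (fun n _ => mFB n)) ndFB.
    rewrite setI_bigcupl.
    have c3 : (P \o (fun n => F n `&` B)) @ \oo --> (P (\bigcup_n F n) * P B)%E.
      rewrite (_ : _ \o _ = fun n => P (F n) * P B)%E; last first.
        by apply/funext => n /=; have [_ ->] := HF n.
      apply: cvgeZr => //; exact: fin_num_measure.
    exact: cvg_unique c2 c3.
- by move=> X GX; split; [exact: G1m|exact: ind].
Qed.

Lemma indep_sigma (G1 G2 : set (set Omega)) :
  setI_closed G1 -> setI_closed G2 -> G1 `<=` measurable -> G2 `<=` measurable ->
  indep_sets G1 G2 -> indep_sets <<s G1 >> <<s G2 >>.
Proof.
move=> I1 I2 m1 m2 /(indep_sets_sigma I1 m1 m2)/indep_setsC h.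
apply: indep_setsC; apply: indep_sets_sigma => //.
by apply: smallest_sub => //; exact: sigma_algebra_measurable.
Qed.

End Independence.

(** * Conditioning on one variable and integration against the exponential law *)

Section JointLaw.
Local Open Scope ereal_scope.
Context (R : realType) d (Omega : measurableType d) (P : probability Omega R).
Context d1 d2 (T1 : measurableType d1) (T2 : measurableType d2).
Variables (X : {mfun Omega >-> T1}) (Y : {mfun Omega >-> T2}).
Hypothesis XY : forall A B, measurable A -> measurable B ->
  P (X @^-1` A `&` Y @^-1` B) = P (X @^-1` A) * P (Y @^-1` B).

(** Independence identifies the law of the pair with the product measure, which is an integral of
    sections. *)
Lemma joint_law (D : set (T1 * T2)) : measurable D ->
  P [set om | D (X om, Y om)] =
  \int[distribution P X]_x P [set om | D (x, Y om)].
Proof.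
move=> mD.
have mXY : measurable_fun setT (fun om => (X om, Y om)) by exact/measurable_fun_pair.
pose XYm : {mfun Omega >-> (T1 * T2)%type} :=
  HB.pack (fun om => (X om, Y om)) (isMeasurableFun.Build _ _ _ _ _ mXY).
have h := @product_measure_unique _ _ _ _ R (distribution P X) (distribution P Y)
  (distribution P XYm) _ D mD.
have <- : distribution P XYm D = P [set om | D (X om, Y om)] by [].
rewrite -h; last by move=> A B mA mB; exact: XY.
apply: eq_integral => x _ /=; rewrite /distribution /pushforward.
by congr (P _); apply/seteqP; split => om; rewrite /= /xsection /= inE.
Qed.

End JointLaw.

Section ExponentialIntegral.
Context (R : realType).
Notation leb := (@lebesgue_measure R).
Variable mu : probability (measurableTypeR R) R.
Hypothesis muE : forall B : set R, measurable B -> mu B = exponential_prob 1 B.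

Lemma exp_law_dominated : mu `<< leb.
Proof.
apply/null_content_dominatesP => A mA A0; rewrite muE//.
rewrite /exponential_prob; apply: null_set_integral => //.
apply/measurable_EFinP; apply: measurable_funTS; exact: measurable_exponential_pdf.
Qed.

Lemma exp_law_integral (f : R -> \bar R) : measurable_fun setT f ->
  (forall x, (0 <= f x <= 1)%E) ->
  (\int[mu]_x f x = \int[leb]_x (f x * (exponential_pdf 1 x)%:E))%E.
Proof.
move=> mf f01.
have intf : mu.-integrable setT f.
  apply/integrableP; split => //.
  apply: (@le_lt_trans _ _ (\int[mu]_x cst 1 x)%E).
    apply: ge0_le_integral => //; first exact: measurableT_comp.
    by move=> x _ /=; have /andP[f0 f1] := f01 x; rewrite gee0_abs.
  rewrite integral_cst// mul1e.
  by apply: le_lt_trans (probability_le1 mu measurableT) _; rewrite ltry.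
rewrite -(Radon_Nikodym_change_of_variables exp_law_dominated)//=.
apply: ae_eq_integral => //.
- apply: emeasurable_funM => //; apply: (measurable_int leb).
  by apply: Radon_Nikodym_integrable; exact: exp_law_dominated.
- apply: emeasurable_funM => //=; apply/measurable_EFinP.
  exact: measurable_exponential_pdf.
- apply: ae_eqe_mul2l => /=.
  rewrite Radon_NikodymE//=; first exact: exp_law_dominated.
  move=> dom; case: cid => /= h [h1 h2 h3].
  apply: integral_ae_eq => //=.
  + by apply/measurable_EFinP; exact: measurable_exponential_pdf.
  + by move=> E _ mE; rewrite -h3//= muE.
Qed.

(** Antiderivative of (a + b s + c s^2) e^(-s), from two integrations by parts. *)
Let prim (a b c : R) (s : R) := - ((a + b + 2 * c) + (b + 2 * c) * s + c * s ^+ 2) * expR (- s).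

Lemma integral_quadratic_exp (a b c N : R) : 0 < N ->
  (\int[leb]_(s in `[0%R, N]) ((a + b * s + c * s ^+ 2) * expR (- s))%:E =
   (a + b + 2 * c - (a + b + 2 * c + (b + 2 * c) * N + c * N ^+ 2) * expR (- N))%:E)%E.
Proof.
move=> N0.
have D (s : R) : is_derive s (1 : R) (prim a b c) ((a + b * s + c * s ^+ 2) * expR (- s)).
  rewrite /prim; apply: is_derive_eq; rewrite /GRing.scale /=.
  by ring.
have C (f : R -> R) : (forall s, derivable f s 1) -> continuous f.
  by move=> df s; apply/differentiable_continuous/derivable1_diffP; exact: df.
have Cp : continuous (prim a b c) by apply: C => s; have := D s => -[].
rewrite (@continuous_FTC2 _ _ (prim a b c))//.
- rewrite /prim -EFinB; congr (_%:E); rewrite oppr0 expR0 expr0n /=; ring.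
- apply: continuous_subspaceT; apply: C => s.
  exact: ex_derive.
- split.
  + by move=> s _; have := D s => -[].
  + by apply: cvg_at_right_filter; exact: Cp.
  + by apply: cvg_at_left_filter; exact: Cp.
- by move=> s _; rewrite derive1E; apply: derive_val.
Qed.

(** a + b + 2 c is the integral of the quadratic over the whole half-line, since s has moments 1 and
    2. The minorant is only available up to [N], where the integral misses this value by a boundary
    term; the last hypothesis gives that term the favourable sign, and beyond [N] positivity of [f]
    suffices. *)
Lemma exp_law_quadratic_le (f : R -> \bar R) (a b c N : R) : 0 < N ->
  measurable_fun setT f -> (forall x, (0 <= f x <= 1)%E) ->
  (forall s, 0 <= s <= N -> ((a + b * s + c * s ^+ 2)%:E <= f s)%E) ->
  a + b + 2 * c + (b + 2 * c) * N + c * N ^+ 2 <= 0 ->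
  ((a + b + 2 * c)%:E <= \int[mu]_x f x)%E.
Proof.
move=> N0 mf f01 fq end0; rewrite exp_law_integral//.
have mpdf : measurable_fun setT (fun x => (exponential_pdf 1 x)%:E : \bar R).
  by apply/measurable_EFinP; exact: measurable_exponential_pdf.
have mfp : measurable_fun setT (fun x => f x * (exponential_pdf 1 x)%:E)%E.
  exact: emeasurable_funM.
have pos x : (0 <= f x * (exponential_pdf 1 x)%:E)%E.
  by apply: mule_ge0; [have /andP[] := f01 x|rewrite lee_fin exponential_pdf_ge0].
apply: (@le_trans _ _ (\int[leb]_(x in `[0%R, N]) (f x * (exponential_pdf 1 x)%:E))%E); last first.
  by apply: ge0_subset_integral.
apply: (@le_trans _ _ (\int[leb]_(s in `[0%R, N]) ((a + b * s + c * s ^+ 2) * expR (- s))%:E)%E).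
  rewrite integral_quadratic_exp// lee_fin lerBrDr gerDl.
  by rewrite mulr_le0_ge0// expR_ge0.
apply: le_integral => //=.
- apply: continuous_compact_integrable; first exact: segment_compact.
  apply: continuous_subspaceT => s.
  apply/differentiable_continuous/derivable1_diffP; exact: ex_derive.
- apply: (@integrableS _ _ _ _ setT) => //.
  apply: (@le_integrable _ _ _ leb setT measurableT _ (EFin \o exponential_pdf 1)) => //.
    move=> x _; rewrite gee0_abs// gee0_abs/= ?lee_fin ?exponential_pdf_ge0//.
    rewrite -[leRHS]mul1e lee_wpmul2r ?lee_fin ?exponential_pdf_ge0//.
    by have /andP[] := f01 x.
  by apply: integrable_exponential_pdf; exact: ltr01.
- move=> s; rewrite inE/= in_itv /= => /andP[s0 sN].
  rewrite exponential_pdfE// mul1r mulN1r EFinM lee_pmul2r ?lte_fin ?expR_gt0//.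
  by apply: fq; rewrite s0.
Qed.

End ExponentialIntegral.

(** The second moment bound (E Z)^2 / E Z^2 for a variable of mean [y] and variance [A]. *)
Definition surv (R : realType) (A y : R) : R := y ^+ 2 / (y ^+ 2 + A).

(** * Effect on the survival bound of adding or subtracting an exponential variable *)

Section HalfSteps.
Context (R : realType) d (Omega : measurableType d) (P : probability Omega R).
Variables (w : {mfun Omega >-> measurableTypeR R}) (X : {mfun Omega >-> \bar R}).
Hypothesis wE : forall B : set R, measurable B -> P (w @^-1` B) = exponential_prob 1 B.
Hypothesis wX : forall A B, measurable A -> measurable B ->
  P (w @^-1` A `&` X @^-1` B) = (P (w @^-1` A) * P (X @^-1` B))%E.

Lemma prob_quadratic_le (D : set (measurableTypeR R * \bar R)) (a b c N : R) :
  measurable D -> 0 < N ->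
  (forall s, 0 <= s <= N ->
     ((a + b * s + c * s ^+ 2)%:E <= P [set om | D (s, X om)])%E) ->
  a + b + 2 * c + (b + 2 * c) * N + c * N ^+ 2 <= 0 ->
  ((a + b + 2 * c)%:E <= P [set om | D (w om, X om)])%E.
Proof.
move=> mD N0 q e; rewrite (joint_law wX mD).
have hE : (fun s => P [set om | D (s, X om)]) = distribution P X \o xsection D.
  apply/funext => s; rewrite /= /distribution /pushforward; congr (P _).
  by apply/seteqP; split => om; rewrite /= /xsection /= inE.
apply: exp_law_quadratic_le N0 _ _ q e => //.
- by rewrite hE; exact: measurable_fun_xsection.
- move=> x; have -> : P [set om | D (x, X om)] = (distribution P X \o xsection D) x.
    by rewrite -hE.
  by rewrite /= probability_le1 ?measure_ge0//; exact: measurable_xsection.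
Qed.

(* AM-GM in the form that makes the survival probability linear in polynomials. *)
Lemma surv_tangent (A y la : R) : 0 < y ^+ 2 + A ->
  2 * la * y - la ^+ 2 * (y ^+ 2 + A) <= surv A y.
Proof.
move=> D0; rewrite /surv ler_pdivlMr// -subr_ge0.
rewrite [leRHS](_ : _ = (y - la * (y ^+ 2 + A)) ^+ 2); last by ring.
exact: sqr_ge0.
Qed.

Lemma surv_tangent_opt (A y : R) : 0 < y ^+ 2 + A ->
  surv A y = 2 * (y / (y ^+ 2 + A)) * y - (y / (y ^+ 2 + A)) ^+ 2 * (y ^+ 2 + A).
Proof. by move=> D0; rewrite /surv; field; rewrite gt_eqF. Qed.

(** Given w = s, the mean is t - s + 1 and the variance [A]. Averaging the tangent quadratic over
    [s] turns them into mean [t] and variance 1 + [A], because s has mean and variance 1. The slope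
    [la] is the optimal one for the target and is the same for all [s]. *)
Lemma surv_add (A t : R) : 0 <= A -> 0 <= t ->
  (forall x, 0 <= x -> ((surv A (x + 1))%:E <= P [set om | (X om <= x%:E)%E])%E) ->
  ((surv (1 + A) t)%:E <= P [set om | ((w om)%:E + X om <= t%:E)%E])%E.
Proof.
move=> A0; rewrite le_eqVlt => /orP[/eqP <- _|t0 h].
  by rewrite /surv expr0n mul0r.
pose D := [set p : measurableTypeR R * \bar R | ((p.1 : R)%:E + p.2 <= t%:E)%E].
have mD : measurable D.
  rewrite -[D]setTI; apply: emeasurable_fun_infty_c => //.
  apply: emeasurable_funD => //; apply/measurable_EFinP; exact: measurable_fst.
have DA : 0 < t ^+ 2 + (1 + A) by apply: ltr_wpDl; [exact: sqr_ge0|lra].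
rewrite surv_tangent_opt//; set la := t / _.
pose u := t + 1.
have E : 2 * la * t - la ^+ 2 * (t ^+ 2 + (1 + A)) =
   (2 * la * u - la ^+ 2 * (u ^+ 2 + A)) + (- 2 * la + 2 * la ^+ 2 * u) + 2 * (- la ^+ 2).
  by rewrite /u; ring.
(* The cut is at [t]: for larger [s] the level t - s is negative and the hypothesis says nothing. *)
rewrite E; apply: (@prob_quadratic_le D _ _ _ t mD t0).
- move=> s /andP[s0 st].
  have -> : [set om | D (s, X om)] = [set om | (X om <= (t - s)%:E)%E].
    by apply/seteqP; split => om; rewrite /D /= EFinB leeBrDl// addeC.
  apply: le_trans (h _ _); last by rewrite subr_ge0.
  rewrite lee_fin; apply: le_trans (@surv_tangent A (t - s + 1) la _).
    by rewrite le_eqVlt; apply/orP; left; apply/eqP; rewrite /u; ring.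
  by apply: ltr_pwDl => //; rewrite exprn_gt0//; lra.
- rewrite [leLHS](_ : _ = - (la ^+ 2 * (1 + A))); last by rewrite /u; ring.
  by rewrite oppr_le0 mulr_ge0 ?sqr_ge0//; lra.
Qed.

(** As for [surv_add], with mean x + s given w = s: averaging over [s] produces mean x + 1 and
    variance 1 + [B]. *)
Lemma surv_sub (B x : R) : 0 < B -> 0 <= x ->
  (forall t, 0 <= t -> ((surv B t)%:E <= P [set om | (X om <= t%:E)%E])%E) ->
  ((surv (1 + B) (x + 1))%:E <= P [set om | (X om - (w om)%:E <= x%:E)%E])%E.
Proof.
move=> B0 x0 h.
pose D := [set p : measurableTypeR R * \bar R | (p.2 - (p.1 : R)%:E <= x%:E)%E].
have mD : measurable D.
  rewrite -[D]setTI; apply: emeasurable_fun_infty_c => //.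
  apply: emeasurable_funB => //; apply/measurable_EFinP; exact: measurable_fst.
have DB : 0 < (x + 1) ^+ 2 + (1 + B) by apply: ltr_wpDl; [exact: sqr_ge0|lra].
rewrite surv_tangent_opt//; set la := (x + 1) / _.
have la0 : 0 < la by rewrite divr_gt0//; lra.
have E : 2 * la * (x + 1) - la ^+ 2 * ((x + 1) ^+ 2 + (1 + B)) =
   (2 * la * x - la ^+ 2 * (x ^+ 2 + B)) + (2 * la - 2 * la ^+ 2 * x) + 2 * (- la ^+ 2).
  by ring.
(* At s = 2 / la the tangent parabola and its first two derivatives are all at most 0, and their sum
   is the boundary term. *)
rewrite E; apply: (@prob_quadratic_le D _ _ _ (2 / la) mD); first by rewrite divr_gt0.
- move=> s /andP[s0 st].
  have -> : [set om | D (s, X om)] = [set om | (X om <= (x + s)%:E)%E].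
    have eqv om : (X om - s%:E <= x%:E)%E = (X om <= (x + s)%:E)%E.
      by rewrite EFinD leeBlDr.
    by apply/seteqP; split => om; rewrite /= -eqv.
  apply: le_trans (h _ _); last lra.
  rewrite lee_fin; apply: le_trans (@surv_tangent B (x + s) la _).
    by rewrite le_eqVlt; apply/orP; left; apply/eqP; ring.
  by apply: ltr_wpDl => //; exact: sqr_ge0.
- have laK : la * (2 / la) = 2 by rewrite mulrC divfK// gt_eqF.
  set N := 2 / la in laK *.
  have la2 : 0 <= la ^+ 2 * B by rewrite mulr_ge0 ?sqr_ge0// ltW.
  have lax : 0 <= la * x by rewrite mulr_ge0// ltW.
  have -> : 2 * la * x - la ^+ 2 * (x ^+ 2 + B) + (2 * la - 2 * la ^+ 2 * x) + 2 * - la ^+ 2 +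
     (2 * la - 2 * la ^+ 2 * x + 2 * - la ^+ 2) * N + - la ^+ 2 * N ^+ 2 =
     2 * (la * x) + 2 * la + 2 * (la * N) - (la * x) ^+ 2 - la ^+ 2 * B
      - 2 * (la * x) * la - 2 * la ^+ 2 - 2 * (la * x) * (la * N) - 2 * la * (la * N) - (la * N) ^+ 2.
    by ring.
  rewrite laK; have := sqr_ge0 la; have := sqr_ge0 (la * x).
  have := mulr_ge0 lax (ltW la0); lra.
Qed.

End HalfSteps.

(** * Sigma-algebras generated by sets of weights *)

Section WeightAlgebras.
Context (R : realType) d (Omega : measurableType d) (P : probability Omega R).
Variables (W : countType) (adj : rel W) (U : W * W -> Omega -> R).
Hypothesis iid : iid_exp1_weights adj P U.

(** Cylinder events over finitely many edges of [S]: a pi-system on which independence can be read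
    off the joint law. *)
Definition weight_rect (S : set (W * W)) : set (set Omega) :=
  [set A | exists s B, [/\ uniq s, all (fun e => adj e.1 e.2) s,
     forall e, e \in s -> S e, forall e, measurable (B e : set R)
   & A = \big[setI/setT]_(e <- s) (U e @^-1` B e)]].

Lemma bigsetI_seqP (s : seq (W * W)) (B : W * W -> set R) om :
  (\big[setI/setT]_(e <- s) (U e @^-1` B e)) om <-> (forall e, e \in s -> B e (U e om)).
Proof. by rewrite -bigcap_seq; split => h e /= es; apply: h. Qed.

Lemma weight_rectI S : setI_closed (weight_rect S).
Proof.
move=> _ _ [s [B [us sadj sS mB ->]]] [s' [B' [us' sadj' sS' mB' ->]]].
exists (undup (s ++ s')), (fun e => (if e \in s then B e else setT) `&`
  (if e \in s' then B' e else setT)); split.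
- exact: undup_uniq.
- apply/allP => e; rewrite mem_undup mem_cat => /orP[/(allP sadj)//|/(allP sadj')//].
- by move=> e; rewrite mem_undup mem_cat => /orP[/sS|/sS'].
- by move=> e; apply: measurableI; case: ifP.
- apply/seteqP; split => om.
    move=> [/bigsetI_seqP h /bigsetI_seqP h']; apply/bigsetI_seqP => e _.
    by split; case: ifP => // es; [exact: h|exact: h'].
  move=> /bigsetI_seqP h; split; apply/bigsetI_seqP => e es.
    by have := h e; rewrite mem_undup mem_cat es => /(_ isT)[].
  by have := h e; rewrite mem_undup mem_cat es orbT => /(_ isT)[].
Qed.

Lemma weight_measurable e (B : set R) : adj e.1 e.2 -> measurable B ->
  measurable (U e @^-1` B).
Proof. by case: iid => h _ _ /h mU mB; rewrite -[_ @^-1` _]setTI; exact: mU. Qed.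

Lemma weight_rect_measurable S : weight_rect S `<=` measurable.
Proof.
move=> _ [s [B [us /allP sadj sS mB ->]]].
rewrite big_seq; elim/big_ind: _ => //; first exact: measurableI.
by move=> e es; apply: weight_measurable => //; exact: sadj.
Qed.

Lemma weight_rect_indep S1 S2 : (forall e, S1 e -> ~ S2 e) ->
  indep_sets P (weight_rect S1) (weight_rect S2).
Proof.
move=> dis _ _ [s [B [us sadj sS mB ->]]] [s' [B' [us' sadj' sS' mB' ->]]].
(* One family [C] glues the two families of target sets, so that the independence hypothesis applies
   to the concatenated list of edges. *)
pose C e := if e \in s then B e else B' e.
have mC e : measurable (C e) by rewrite /C; case: ifP.
have ns e : e \in s' -> e \in s = false.
  by move=> es'; apply/negP => es; exact: dis (sS _ es) (sS' _ es').
have uss : uniq (s ++ s').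
  rewrite cat_uniq us us' andbT; apply/hasPn => e es' /=; by rewrite ns.
have [_ _ ind] := iid.
have E1 : \big[setI/setT]_(e <- s) (U e @^-1` B e) = \big[setI/setT]_(e <- s) (U e @^-1` C e).
  by apply: eq_big_seq => e es; rewrite /C es.
have E2 : \big[setI/setT]_(e <- s') (U e @^-1` B' e) = \big[setI/setT]_(e <- s') (U e @^-1` C e).
  by apply: eq_big_seq => e es; rewrite /C ns.
rewrite E1 E2 -big_cat ind//; last by rewrite all_cat sadj.
by rewrite big_cat /= !ind.
Qed.

(** [Omega] with only the sigma-algebra of the weights in [S]. Measurability on this type expresses
    that a function depends on those weights alone, and independence follows from disjointness of
    the sets. *)
Definition weightT (S : set (W * W)) := g_sigma_algebraType (weight_rect S).

Lemma weight_sigma_sub S A : <<s weight_rect S >> A -> measurable A.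
Proof.
move: A; apply: smallest_sub; last exact: weight_rect_measurable.
exact: sigma_algebra_measurable.
Qed.

Lemma weightT_measurable S d' (T : measurableType d') (f : Omega -> T) :
  measurable_fun (setT : set (weightT S)) f -> measurable_fun setT f.
Proof.
by move=> mf _ B mB; apply: (@weight_sigma_sub S); exact: (mf measurableT B mB).
Qed.

Lemma weightT_weight S e : S e -> adj e.1 e.2 ->
  measurable_fun (setT : set (weightT S)) (U e : weightT S -> measurableTypeR R).
Proof.
move=> Se ae _ B mB; apply: sub_sigma_algebra; rewrite setTI.
exists [:: e], (fun=> B); split => //; first by rewrite /= ae.
- by move=> e'; rewrite inE => /eqP->.
- by rewrite big_seq1.
Qed.

Lemma weightT_indep S1 S2 d1 d2 (T1 : measurableType d1) (T2 : measurableType d2)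
    (f : Omega -> T1) (g : Omega -> T2) : (forall e, S1 e -> ~ S2 e) ->
  measurable_fun (setT : set (weightT S1)) f ->
  measurable_fun (setT : set (weightT S2)) g ->
  forall A B, measurable A -> measurable B ->
  P (f @^-1` A `&` g @^-1` B) = (P (f @^-1` A) * P (g @^-1` B))%E.
Proof.
move=> dis mf mg A B mA mB.
have h := indep_sigma (@weight_rectI S1) (@weight_rectI S2)
  (@weight_rect_measurable S1) (@weight_rect_measurable S2) (weight_rect_indep dis).
apply: h; rewrite -[_ @^-1` _]setTI; [exact: (mf measurableT A mA)|exact: (mg measurableT B mB)].
Qed.

End WeightAlgebras.

(** * Survival estimate *)

Section BarrierMeasurable.
Context (R : realType) d (Omega : measurableType d).
Variables (W : countType) (nbr : W -> seq W) (U : W * W -> Omega -> R).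

Definition wt (om : Omega) : W * W -> R := fun e => U e om.

Lemma measurable_bigmine d' (T : measurableType d') (r : seq W) (Q : pred W)
    (f : W -> T -> \bar R) :
  (forall c, c \in r -> Q c -> measurable_fun setT (f c)) ->
  measurable_fun setT (fun x => \big[mine/+oo%E]_(c <- r | Q c) f c x).
Proof.
elim: r => [_|c r IH h].
  rewrite (_ : (fun _ => _) = cst +oo%E); first exact: measurable_cst.
  by apply/funext => x; rewrite big_nil.
have m1 : measurable_fun setT (fun x => \big[mine/+oo%E]_(c <- r | Q c) f c x).
  by apply: IH => b br; apply: h; rewrite inE br orbT.
have [Qc|nQc] := boolP (Q c).
  rewrite (_ : (fun _ => _) = fun x => mine (f c x) (\big[mine/+oo%E]_(c <- r | Q c) f c x)).
    by apply: measurable_mine => //; apply: h => //; rewrite inE eqxx.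
  by apply/funext => x; rewrite big_cons Qc.
rewrite (_ : (fun _ => _) = fun x => \big[mine/+oo%E]_(c <- r | Q c) f c x)//.
by apply/funext => x; rewrite big_cons (negbTE nQc).
Qed.

Section OnAlgebra.
Context d' (T : measurableType d') (g : T -> Omega).
Variable Q : W -> W -> Prop.
Hypothesis Qback : forall a b, Q a b -> a \in nbr b.
Hypothesis Qmeas : forall a b, Q a b -> forall c, c \in nbr b ->
  measurable_fun setT (fun x => U (b, c) (g x)).
Hypothesis Qnext : forall a b c, Q a b -> c \in nbr b -> c != a -> Q b c.

(** [Q] is an invariant of non-backtracking steps, so it holds at every oriented edge that the
    recursion visits. The map [g] allows [T] to be [Omega] with a smaller sigma-algebra. *)
Lemma barrier_measurable n a b : Q a b ->
  measurable_fun setT (fun x => barrier nbr (wt (g x)) n a b).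
Proof.
elim: n a b => [|n IH] a b Qab; first exact: measurable_cst.
apply: measurable_maxe; first exact: measurable_cst.
apply: emeasurable_funB; last by apply/measurable_EFinP; apply: Qmeas Qab _ (Qback Qab).
apply: (@measurable_bigmine _ _ _ _
  (fun c x => (wt (g x) (b, c))%:E + barrier nbr (wt (g x)) n b c)%E) => c cb ca.
apply: emeasurable_funD; first by apply/measurable_EFinP; apply: Qmeas Qab _ cb.
exact: IH (Qnext Qab cb ca).
Qed.

Lemma barrier_lim_measurable a b : Q a b ->
  measurable_fun setT (fun x => barrier_lim nbr (wt (g x)) a b).
Proof.
move=> Qab.
apply: (emeasurable_fun_cvg (fun n x => barrier nbr (wt (g x)) n a b)).
  by move=> n; exact: barrier_measurable.
move=> x _; apply: ereal_nondecreasing_cvgn => m n mn; exact: barrier_mono.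
Qed.

End OnAlgebra.
End BarrierMeasurable.

Section Survival.
Context (R : realType) d (Omega : measurableType d) (P : probability Omega R).
Variables (W : countType) (adj : rel W) (o : W) (par : W -> W) (dep : W -> nat).
Variable ch : W -> seq W.
Hypothesis rt : rooted_tree adj o par dep ch.
Local Notation nbr := (rnbr o par ch).
Variable U : W * W -> Omega -> R.
Hypothesis iid : iid_exp1_weights adj P U.
Local Notation wt := (wt U).
Local Notation weightT := (weightT adj U).

Let ch_nbr v y : y \in ch v -> y \in nbr v.
Proof. by rewrite /rnbr; case: eqP => // _ yv; rewrite inE yv orbT. Qed.

Let ch_adj v y : y \in ch v -> adj v y.
Proof. by move=> /ch_nbr; rewrite (rt_adj rt). Qed.

Let nbr_ch a b c : b \in ch a -> c \in nbr b -> c != a -> c \in ch b.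
Proof.
rewrite (rt_ch rt) => /andP[bo /eqP pb]; rewrite /rnbr (negbTE bo) inE pb.
by case: eqP.
Qed.

Definition cost n v y om : \bar R := ((wt om (v, y))%:E + barrier nbr (wt om) n v y)%E.

(** The edges whose weights determine the cost of leaving [v] through its child [y]. Arms of
    distinct children are disjoint, which makes their costs independent. *)
Definition arm v y : set (W * W) := [set e | e = (v, y) \/ anc par dep y e.1].

Let arm_back S v y n : y \in ch v -> (forall e, anc par dep y e.1 -> S e) ->
  measurable_fun (setT : set (weightT S)) (fun om => barrier nbr (wt om) n v y).
Proof.
move=> yv armS.
apply: (@barrier_measurable _ _ _ _ _ _ _ (weightT S) id
  (fun a b => b \in ch a /\ anc par dep y b)).
- move=> a b [ba _]; rewrite -(rt_adj rt) (rt_sym rt); exact: ch_adj.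
- move=> a b [ba yb] c cb; apply: weightT_weight; last by rewrite (rt_adj rt).
  by exact: armS.
- move=> a b c [ba yb] cb ca; have cc := nbr_ch ba cb ca; split => //.
  exact: (anc_ch rt cc yb).
- by split => //; exact: anc_refl.
Qed.

Lemma cost_measurable S v y n : y \in ch v -> arm v y `<=` S ->
  measurable_fun (setT : set (weightT S)) (cost n v y).
Proof.
move=> yv armS; apply: emeasurable_funD; last by apply: arm_back => // e ye; apply: armS; right.
apply/measurable_EFinP; apply: weightT_weight; last exact: ch_adj.
by apply: armS; left.
Qed.

Let dep_ch v y : y \in ch v -> dep y = (dep v).+1.
Proof. by rewrite (rt_ch rt) => /andP[yo /eqP <-]; exact: (rt_dep rt yo). Qed.

Lemma arm_disjoint v y z e : y \in ch v -> z \in ch v -> y != z ->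
  arm v y e -> ~ arm v z e.
Proof.
move=> yv zv yz; have dy := dep_ch yv; have dz := dep_ch zv.
have na u : u \in ch v -> ~~ anc par dep u v.
  by move=> /dep_ch du; rewrite /anc du ltnn.
move=> [->|ye] [[]|ze] => [/eqP||/=|]; first by rewrite (negbTE yz).
- by rewrite (negbTE (na _ zv)) in ze.
- by move=> ee; move: ye; rewrite ee/= (negbTE (na _ yv)).
- by move/eqP: yz; apply; apply: anc_eq ye ze; rewrite dy dz.
Qed.

Let mfunU (f : Omega -> \bar R) S : measurable_fun (setT : set (weightT S)) f ->
  {g : {mfun Omega >-> \bar R} | g = f :> (_ -> _)}.
Proof.
move=> /(weightT_measurable iid) mf.
pose g : {mfun Omega >-> \bar R} := HB.pack f (isMeasurableFun.Build _ _ _ _ f mf).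
by exists g.
Qed.

(** The parallel law: the tails multiply by independence, and (1 + k)(1 + k') >= 1 + k + k' for
    nonnegative numbers. *)
Lemma prob_min_gt n v t (k : W -> R) (r : seq W) :
  uniq r -> {subset r <= ch v} -> (forall y, y \in r -> 0 <= k y) ->
  (forall y, y \in r -> (P [set om | (t%:E < cost n v y om)%E] <= ((1 + k y)^-1)%:E)%E) ->
  (P [set om | (t%:E < \big[mine/+oo]_(y <- r) cost n v y om)%E]
    <= ((1 + \sum_(y <- r) k y)^-1)%:E)%E.
Proof.
elim: r => [_ _ _ _|y r IH /= /andP[yr ur] sub k0 h].
  by rewrite big_nil addr0 invr1; apply: probability_le1; rewrite -[X in measurable X]setTI;
    under eq_fun do rewrite big_nil; apply: emeasurable_fun_o_infty => //.
have sub' : {subset r <= ch v} by move=> z zr; apply: sub; rewrite inE zr orbT.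
have yv : y \in ch v by apply: sub; rewrite inE eqxx.
have IH' := IH ur sub' (fun z zr => k0 z (@mem_behead _ (_ :: _) _ zr))
  (fun z zr => h z (@mem_behead _ (_ :: _) _ zr)).
pose S2 := [set e | exists2 z, z \in r & arm v z e].
have mm : measurable_fun (setT : set (weightT S2))
    (fun om => \big[mine/+oo%E]_(z <- r) cost n v z om).
  apply: (@measurable_bigmine _ _ _ (weightT S2)) => z zr _.
  by apply: cost_measurable => [|e ze]; [exact: sub'|exists z].
have my : measurable_fun (setT : set (weightT (arm v y))) (cost n v y).
  exact: cost_measurable.
have dis e : arm v y e -> ~ S2 e.
  move=> ye [z zr]; apply: arm_disjoint ye => //; first exact: sub'.
  by apply: contraNneq yr => ->.
pose B := [set x : \bar R | (t%:E < x)%E].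
have mB : measurable B.
  by rewrite -[B]setTI; apply: emeasurable_fun_o_infty => //; exact: measurable_id.
rewrite (_ : [set om | _] = (cost n v y @^-1` B) `&`
   ((fun om => \big[mine/+oo%E]_(z <- r) cost n v z om) @^-1` B)); last first.
  apply/seteqP; split => om; rewrite /= big_cons lt_min.
    by move=> /andP.
  by move=> [-> ->].
rewrite (weightT_indep iid dis my mm mB mB) big_cons.
have s0 : 0 <= \sum_(z <- r) k z.
  by rewrite big_seq; apply: sumr_ge0 => z zr; apply: k0; rewrite inE zr orbT.
have ky : 0 <= k y by apply: k0; rewrite inE eqxx.
apply: (@le_trans _ _ ((1 + k y)^-1%:E * (1 + \sum_(z <- r) k z)^-1%:E)%E).
  by apply: lee_pmul => //; apply: h; rewrite inE eqxx.
rewrite -EFinM lee_fin -invfM lef_pV2 ?posrE; last 2 first.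
- by apply: mulr_gt0; lra.
- by lra.
have := mulr_ge0 ky s0; lra.
Qed.

Lemma surv_compl (A y : R) : 0 < A -> 1 - surv A y = (1 + y ^+ 2 / A)^-1.
Proof.
move=> A0; rewrite /surv; have := sqr_ge0 y; set q := y ^+ 2 => q0.
by field; rewrite !gt_eqF//; lra.
Qed.

Lemma surv_anti (A B y : R) : 0 < A -> A <= B -> surv B y <= surv A y.
Proof.
move=> A0 AB; have := sqr_ge0 y; rewrite /surv; set q := y ^+ 2 => q0.
by rewrite ler_wpM2l// lef_pV2 ?posrE; lra.
Qed.

Lemma prob_le_gt (f : Omega -> \bar R) t c : measurable_fun setT f ->
  ((1 - c)%:E <= P [set om | (f om <= t%:E)%E])%E ->
  (P [set om | (t%:E < f om)%E] <= c%:E)%E.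
Proof.
move=> mf h.
have m1 : measurable [set om | (f om <= t%:E)%E].
  by rewrite -[X in measurable X]setTI; exact: emeasurable_fun_infty_c.
have -> : [set om | (t%:E < f om)%E] = ~` [set om | (f om <= t%:E)%E].
  by apply/seteqP; split => om; rewrite /= ltNge => /negP.
rewrite probability_setC//; move: h; set p := P _.
have /fineK <- : p \is a fin_num by exact: fin_num_measure.
by rewrite -EFinB !lee_fin; lra.
Qed.

Lemma prob_gt_le (f : Omega -> \bar R) t c : measurable_fun setT f ->
  (P [set om | (t%:E < f om)%E] <= c%:E)%E ->
  ((1 - c)%:E <= P [set om | (f om <= t%:E)%E])%E.
Proof.
move=> mf h.
have m1 : measurable [set om | (t%:E < f om)%E].
  by rewrite -[X in measurable X]setTI; exact: emeasurable_fun_o_infty.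
have -> : [set om | (f om <= t%:E)%E] = ~` [set om | (t%:E < f om)%E].
  by apply/seteqP; split => om; rewrite /= leNgt => /negP.
by rewrite probability_setC// EFinB; apply: leeB.
Qed.

Let mfU e : adj e.1 e.2 ->
  {g : {mfun Omega >-> measurableTypeR R} | g = U e :> (_ -> _)}.
Proof.
case: iid => mU _ _ /mU mUe.
have mUe' : measurable_fun setT (U e : Omega -> measurableTypeR R).
  by move=> _ B mB; exact: mUe.
pose g : {mfun Omega >-> measurableTypeR R} :=
  HB.pack (U e : Omega -> measurableTypeR R)
    (isMeasurableFun.Build _ _ _ (measurableTypeR R) (U e : Omega -> measurableTypeR R) mUe').
by exists g.
Qed.

Variables (th F : W -> R) (M : R).
Hypothesis M0 : 0 < M.
Hypothesis th0 : forall v, 0 <= th v.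
Hypothesis thS : forall v, v != o -> \sum_(y <- ch v) th y = th v.
Hypothesis F0 : forall v, 0 < F v.
Hypothesis thF : forall v, v != o -> th v <= M * (F (par v) - F v).

Let C v := 2 * M * F v.
Let C0 v : 0 < C v. Proof. by rewrite !mulr_gt0. Qed.

(** The term 1 is the variance of the turn-back weight, subtracted last; [C v / th v] accounts for
    everything beyond [v]. *)
Definition resist v := 1 + C v / th v.

Let cost_mOmega n v y : y \in ch v -> measurable_fun setT (cost n v y).
Proof.
move=> yv; apply: (weightT_measurable iid (S := arm v y)).
exact: cost_measurable.
Qed.

(** Adding w(v,y) raises the variance to 2 + C y / th y, which is at most C v / th y because 2 th y
    <= 2 M (F v - F y). A branch without flow contributes only the trivial bound 1. *)
Lemma cost_tail n v y t : y \in ch v -> 0 <= t ->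
  (0 < th y -> forall x, 0 <= x -> ((surv (resist y) (x + 1))%:E <=
     P [set om | (barrier nbr (wt om) n v y <= x%:E)%E])%E) ->
  (P [set om | (t%:E < cost n v y om)%E] <= ((1 + th y * (t ^+ 2 / C v))^-1)%:E)%E.
Proof.
move=> yv t0 IH; have yv' := yv; move: yv'; rewrite (rt_ch rt) => /andP[yo /eqP py].
have [thy|] := ltP 0 (th y); last first.
  move=> thle; have -> : th y = 0 by apply/eqP; rewrite eq_le thle th0.
  rewrite mul0r addr0 invr1; apply: probability_le1.
  rewrite -[X in measurable X]setTI; apply: emeasurable_fun_o_infty => //.
  exact: cost_mOmega.
apply: prob_le_gt; first exact: cost_mOmega.
have mX := @arm_back [set e | anc par dep y e.1] v y n yv (fun _ => id).
have [X XE] := mfunU mX.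
have [w wE] := mfU (ch_adj yv : adj (v, y).1 (v, y).2).
have mw := @weightT_weight _ _ _ _ adj U [set (v, y)] (v, y) erefl (ch_adj yv).
have dis e : [set (v, y)] e -> ~ [set e | anc par dep y e.1] e.
  by move=> -> /=; rewrite /anc (dep_ch yv) ltnn.
have A0 : 0 <= resist y by rewrite addr_ge0// divr_ge0// ltW.
have := @surv_add _ _ _ P w X _ _ (resist y) t A0 t0.
rewrite XE wE => h.
have {h} := h _ _ (IH thy).
have -> : [set om | ((U (v, y) om)%:E + barrier nbr (wt om) n v y <= t%:E)%E] =
  [set om | (cost n v y om <= t%:E)%E] by [].
have lawU B : measurable B -> P (U (v, y) @^-1` B) = exponential_prob 1 B.
  by move=> mB; case: iid => _ + _; apply => //; exact: ch_adj.
move=> /(_ lawU (weightT_indep iid dis mw mX)); apply: le_trans.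
rewrite lee_fin.
have D0 : 0 < C v / th y by rewrite divr_gt0.
have -> : th y * (t ^+ 2 / C v) = t ^+ 2 / (C v / th y).
  by field; rewrite !gt_eqF.
rewrite -surv_compl// opprB addrCA subrr addr0.
apply: surv_anti; first by rewrite ltr_pwDl.
rewrite /resist addrA ler_pdivlMr// mulrDl divfK ?gt_eqF//.
have := thF yo; rewrite py /C; lra.
Qed.

Lemma min_tail n v t (Th := \sum_(y <- ch v) th y) : 0 <= t ->
  (forall y, y \in ch v -> 0 < th y -> forall x, 0 <= x ->
     ((surv (resist y) (x + 1))%:E <=
        P [set om | (barrier nbr (wt om) n v y <= x%:E)%E])%E) ->
  (P [set om | (t%:E < \big[mine/+oo]_(y <- ch v) cost n v y om)%E] <=
     ((1 + Th * (t ^+ 2 / C v))^-1)%:E)%E.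
Proof.
move=> t0 IH; rewrite /Th mulr_suml; apply: prob_min_gt => //.
- exact: (rt_uniq rt).
- by move=> y _; rewrite mulr_ge0// divr_ge0 ?sqr_ge0// ltW.
- by move=> y yv; apply: cost_tail => // thy; exact: IH.
Qed.

Lemma big_nbr_ch v a (f : W -> \bar R) : v \in ch a ->
  \big[mine/+oo%E]_(c <- nbr v | c != a) f c = \big[mine/+oo%E]_(c <- ch v) f c.
Proof.
move=> va; move: (va); rewrite (rt_ch rt) => /andP[vo /eqP pv].
rewrite /rnbr (negbTE vo) big_cons pv eqxx /= big_seq_cond [RHS]big_seq.
apply: eq_bigl => c; have [cv|//] := boolP (c \in ch v).
apply/eqP => ca; have := dep_ch cv; have := dep_ch va; rewrite ca; lia.
Qed.

Lemma surv_le1 (A y : R) : 0 < A -> surv A y <= 1.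
Proof.
move=> A0; rewrite -subr_ge0 surv_compl// invr_ge0 addr_ge0// divr_ge0 ?sqr_ge0//.
exact: ltW.
Qed.

(** By conservation of the flow, the parallel law over the children of [v] yields exactly the
    variance C v / th v for the minimum; subtracting the turn-back weight adds 1 and moves the mean
    from [x] to x + 1, which reproduces the statement. *)
Lemma barrier_survival n a v : v \in ch a -> 0 < th v -> forall x, 0 <= x ->
  ((surv (resist v) (x + 1))%:E <= P [set om | (barrier nbr (wt om) n a v <= x%:E)%E])%E.
Proof.
elim: n a v => [|n IH] a v va thv x x0.
  have -> : [set om | (barrier nbr (wt om) 0 a v <= x%:E)%E] = setT.
    by apply/seteqP; split => om //= _; rewrite lee_fin.
  rewrite probability_setT lee_fin surv_le1// ltr_pwDl//.
  by rewrite divr_ge0// ltW.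
have va' := va; move: va'; rewrite (rt_ch rt) => /andP[vo /eqP pv].
have sumth := thS vo.
(* The turn-back edge (v, a) is left out, so its weight is independent of the minimum over the
   children. *)
pose S1 := [set e : W * W | e.1 = v /\ e.2 != a \/ exists2 y, y \in ch v & anc par dep y e.1].
have mm : measurable_fun (setT : set (weightT S1))
    (fun om => \big[mine/+oo%E]_(y <- ch v) cost n v y om).
  apply: (@measurable_bigmine _ _ _ (weightT S1)) => y yv _.
  apply: cost_measurable => // e [->|ye].
    left; split => //=; apply/eqP => ya.
    by have := dep_ch yv; have := dep_ch va; rewrite ya; lia.
  by right; exists y.
have ava : adj v a by rewrite (rt_sym rt); exact: ch_adj.
have mw := @weightT_weight _ _ _ _ adj U [set (v, a)] (v, a) erefl ava.
have dis e : [set (v, a)] e -> ~ S1 e.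
  move=> -> [[_ /=]|[y yv]]; first by rewrite eqxx.
  by rewrite /anc (dep_ch yv) ltnn.
have [X XE] := mfunU mm.
have [w wE] := mfU (ava : adj (v, a).1 (v, a).2).
have B0 : 0 < C v / th v by rewrite divr_gt0.
have := @surv_sub _ _ _ P w X _ _ (C v / th v) x B0 x0.
rewrite XE wE => h.
have -> : [set om | (barrier nbr (wt om) n.+1 a v <= x%:E)%E] =
  [set om | (\big[mine/+oo]_(y <- ch v) cost n v y om - (U (v, a) om)%:E <= x%:E)%E].
  have eqv om : (barrier nbr (wt om) n.+1 a v <= x%:E)%E =
      (\big[mine/+oo]_(y <- ch v) cost n v y om - (U (v, a) om)%:E <= x%:E)%E.
    by rewrite barrierS (big_nbr_ch _ va) ge_max lee_fin x0.
  by apply/seteqP; split => om /=; rewrite -eqv.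
apply: h => //.
- by move=> B mB; case: iid => _ + _; apply.
- exact: (weightT_indep iid dis mw mm).
- move=> t t0.
  have := min_tail t0 (fun y yv thy => IH v y yv thy).
  rewrite sumth => {}h.
  have mO : measurable_fun setT (fun om => \big[mine/+oo%E]_(y <- ch v) cost n v y om).
    exact: (weightT_measurable iid mm).
  apply: le_trans (prob_gt_le mO h); rewrite lee_fin.
  have -> : th v * (t ^+ 2 / C v) = t ^+ 2 / (C v / th v).
    by field; rewrite !gt_eqF.
  by rewrite -surv_compl// opprB addrCA subrr addr0.
Qed.

End Survival.

(** * Almost sure uniqueness and finiteness of the minimizer *)

Section AlmostSure.
Context (R : realType) d (Omega : measurableType d) (P : probability Omega R).
Variables (W : countType) (adj : rel W) (o : W) (par : W -> W) (dep : W -> nat).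
Variable ch : W -> seq W.
Hypothesis rt : rooted_tree adj o par dep ch.
Local Notation nbr := (rnbr o par ch).
Variable U : W * W -> Omega -> R.
Hypothesis iid : iid_exp1_weights adj P U.
Local Notation wt := (wt U).
Local Notation weightT := (weightT adj U).

(** Given [Z], the weight of [e] is still exponential, hence hits a prescribed value with
    probability 0. *)
Lemma prob_eq_weight_measurable e (Z : Omega -> R) (S : set (W * W)) :
  adj e.1 e.2 -> ~ S e ->
  measurable_fun (setT : set (weightT S)) (Z : _ -> measurableTypeR R) ->
  P.-negligible [set om | Z om = U e om].
Proof.
move=> ae Se mZ.
have mO := weightT_measurable iid mZ.
pose X : {mfun Omega >-> measurableTypeR R} := HB.pack (Z : Omega -> measurableTypeR R)
  (isMeasurableFun.Build _ _ _ (measurableTypeR R) (Z : Omega -> measurableTypeR R) mO).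
have mw := @weightT_weight _ _ _ _ adj U [set e] e erefl ae.
have mwO := weightT_measurable iid mw.
pose w : {mfun Omega >-> measurableTypeR R} := HB.pack (U e : Omega -> measurableTypeR R)
  (isMeasurableFun.Build _ _ _ (measurableTypeR R) (U e : Omega -> measurableTypeR R) mwO).
have dis e' : S e' -> ~ [set e] e' by move=> + ee; rewrite ee.
have ind : forall A B, measurable A -> measurable B ->
    P (X @^-1` A `&` w @^-1` B) = (P (X @^-1` A) * P (w @^-1` B))%E.
  exact: (weightT_indep iid dis mZ mw).
pose D := [set p : measurableTypeR R * measurableTypeR R | (p.1 : R) = p.2].
have mD : measurable D.
  have mf : measurable_fun setT (fun p : measurableTypeR R * measurableTypeR R =>
      (p.1 : R) - p.2).
    by apply: measurable_funB; [exact: measurable_fst|exact: measurable_snd].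
  rewrite (_ : D = setT `&` (fun p : measurableTypeR R * measurableTypeR R =>
      (p.1 : R) - p.2) @^-1` [set 0]); last first.
    apply/seteqP; split => -[p q]; rewrite /D /=.
      by move=> ->; rewrite subrr.
    by move=> [_ /eqP]; rewrite subr_eq0 => /eqP.
  by apply: mf => //; exact: measurable_set1.
exists [set om | D (X om, w om)]; split => //.
- rewrite -[X in measurable X]setTI.
  have mXw : measurable_fun setT (fun om => (X om, w om)) by exact/measurable_fun_pair.
  exact: mXw.
- rewrite (joint_law ind mD) (_ : (fun _ => _) = cst 0%E) ?integral_cst// ?mul0e//.
  apply/funext => x; rewrite /=.
  have -> : [set om | D (x, U e om)] = U e @^-1` [set x].
    by apply/seteqP; split => om; rewrite /D /= => ->.
  case: iid => _ + _ => ->//; rewrite /exponential_prob.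
  apply: null_set_integral => //; last exact: lebesgue_measure_set1.
  by apply/measurable_EFinP; apply: measurable_funTS; exact: measurable_exponential_pdf.
Qed.

(** Oriented edges reached by non-backtracking walks from [v], upwards as well as downwards.
    Self-avoidance keeps [b] away from [v], so the recursion for the barrier of (v, y) never reads a
    weight with tail [v]. *)
Let away v a b := exists s, nbtl adj (s ++ [:: a; b]) /\ head b (s ++ [:: a]) = v.

Let away_adj v a b : away v a b -> adj a b /\ b != v.
Proof.
case=> s [nb hv]; have := nbtl_uniq rt nb; have := nbtl_sorted nb.
move=> /cat_sorted2[_ /= /andP[-> _]].
rewrite -[[:: a; b]]cat1s catA cat_uniq /= orbF => /and3P[_ + _] => bs; split => //.
by apply: contra bs => /eqP->; rewrite -hv; case: (s) => [|x t]; rewrite /= mem_head.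
Qed.

Lemma barrier_lim_away v y S : y \in nbr v -> (forall e, e.1 != v -> S e) ->
  measurable_fun (setT : set (weightT S)) (fun om => barrier_lim nbr (wt om) v y).
Proof.
move=> yv vS.
apply: (@barrier_lim_measurable _ _ _ _ _ _ _ (weightT S) id (away v)).
- by move=> a b /away_adj[ab _]; rewrite -(rt_adj rt) (rt_sym rt).
- move=> a b /away_adj[ab bv] c cb; apply: weightT_weight; last by rewrite (rt_adj rt).
  exact: vS.
- move=> a b c [s [nb hv]] cb ca; exists (s ++ [:: a]); rewrite -!catA /=; split.
    by apply: nbtl_rcons => //; rewrite (rt_adj rt).
  by case: (s) hv => //.
- by exists [::]; rewrite /= andbT (rt_adj rt).
Qed.

Lemma exit_cost_tie v y z : y \in nbr v -> z \in nbr v -> y != z ->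
  P.-negligible [set om | (exit_cost o par ch (wt om) v y < +oo)%E /\
    exit_cost o par ch (wt om) v y = exit_cost o par ch (wt om) v z].
Proof.
move=> yv zv yz.
pose S := [set e : W * W | e.1 != v \/ e = (v, z)].
have vy : adj (v, y).1 (v, y).2 by rewrite (rt_adj rt).
have vz : adj (v, z).1 (v, z).2 by rewrite (rt_adj rt).
have nS : ~ S (v, y).
  by move=> [/=|[/eqP]]; rewrite ?eqxx// (negbTE yz).
(* [Z] solves the tie for the weight of (v, y). On a tie of finite costs all terms are finite, and
   [fine] loses nothing. *)
pose Z om := fine ((wt om (v, z))%:E + barrier_lim nbr (wt om) v z - barrier_lim nbr (wt om) v y)%E.
have mZ : measurable_fun (setT : set (weightT S)) (Z : _ -> measurableTypeR R).
  apply: measurableT_comp => //.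
  apply: emeasurable_funB; last by apply: barrier_lim_away => // e ev; left.
  apply: emeasurable_funD; last by apply: barrier_lim_away => // e ev; left.
  by apply/measurable_EFinP; apply: (weightT_weight (e := (v, z))) => //; right.
apply: negligibleS (prob_eq_weight_measurable vy nS mZ).
move=> om /= []; rewrite /exit_cost /Z.
have := barrier_lim_ge0 nbr (wt om) v y; case: (barrier_lim nbr (wt om) v y) => [r| |]//.
by move=> _ _ <-; rewrite -!EFinD /= addrK.
Qed.

Lemma negligible_exists_seq (T : eqType) (r : seq T) (A : T -> set Omega) :
  (forall y, y \in r -> P.-negligible (A y)) ->
  P.-negligible [set om | exists2 y, y \in r & A y om].
Proof.
elim: r => [_|y r IH h].
  by apply: negligibleS (negligible_set0 P) => om [].
apply: negligibleS (negligibleU (h y (mem_head _ _))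
  (IH (fun z zr => h z (@mem_behead _ (_ :: _) _ zr)))).
by move=> om [z]; rewrite inE => /orP[/eqP->|zr] Az; [left|right; exists z].
Qed.

Variables (th F : W -> R) (M : R).
Hypothesis M0 : 0 < M.
Hypothesis th0 : forall v, 0 <= th v.
Hypothesis thS : forall v, v != o -> \sum_(y <- ch v) th y = th v.
Hypothesis thO : 0 < \sum_(y <- ch o) th y.
Hypothesis F0 : forall v, 0 < F v.
Hypothesis thF : forall v, v != o -> th v <= M * (F (par v) - F v).

(** The tail bound on the minimum at the root does not depend on the depth, and the events increase
    with it, so their union obeys the same bound, of order k^-2. Outside a null set some level [k]
    bounds the minimum at all depths, and the pigeonhole lemma provides an exit. *)
Lemma root_no_exit : P.-negligible [set om | ~ has_exit nbr (wt om) o].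
Proof.
pose mn n om := \big[mine/+oo%E]_(y <- ch o) cost o par ch U n o y om.
pose a := (\sum_(y <- ch o) th y) / (2 * M * F o).
have a0 : 0 < a by rewrite divr_gt0// !mulr_gt0.
pose A k n := [set om | (k%:R%:E < mn n om)%E].
have PA k n : (P (A k n) <= ((1 + a * k%:R ^+ 2)^-1)%:E)%E.
  have := min_tail rt iid M0 th0 F0 thF (ler0n R k)
    (fun y yo thy => barrier_survival rt iid M0 th0 thS F0 thF n yo thy).
  by rewrite /a mulrAC -mulrA => /(_ o).
have mmn n : measurable_fun setT (mn n).
  apply: measurable_bigmine => y yo _.
  apply: (weightT_measurable iid (S := arm par dep o y)).
  exact: (cost_measurable rt).
have mA k n : measurable (A k n).
  by rewrite -[A k n]setTI; apply: emeasurable_fun_o_infty.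
have ndA k : nondecreasing_seq (A k).
  move=> m n mn'; apply/subsetPset => om; rewrite /A /= => h.
  apply: lt_le_trans h _; apply: le_bigmine_seq => y yo _.
  apply: le_trans (bigmine_le _ yo isT) _.
  by rewrite leeD2l// barrier_mono.
have mU k : measurable (\bigcup_n A k n) by exact: bigcup_measurable.
have PU k : (P (\bigcup_n A k n) <= ((1 + a * k%:R ^+ 2)^-1)%:E)%E.
  have c := nondecreasing_cvg_mu (mu := P) (mA k) (mU k) (ndA k).
  rewrite -(cvg_lim _ c)//; apply: lime_le; first by apply/cvg_ex; eexists; exact: c.
  by apply: nearW => n; exact: PA.
exists (\bigcap_k \bigcup_n A k n); split.
- exact: bigcap_measurableType.
- set N := \bigcap_k _.
  have mN : measurable N by exact: bigcap_measurableType.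
  have PN k : (P N <= ((1 + a * k%:R ^+ 2)^-1)%:E)%E.
    by apply: le_trans (PU k); apply: le_measure; rewrite ?inE//; exact: bigcap_inf.
  have fN : P N \is a fin_num by exact: fin_num_measure.
  rewrite -(fineK fN); congr (_%:E); apply/eqP; rewrite eq_le fine_ge0// andbT.
  rewrite leNgt; apply/negP => p0; set p := fine (P N) in p0.
  have {}PN k : p <= (1 + a * k%:R ^+ 2)^-1 by rewrite -lee_fin fineK.
  have ap : 0 < a * p by rewrite mulr_gt0.
  (* The bound at level [k] reads p (1 + a k^2) <= 1. Here k > (a p)^-1, and the successor ensures k
     >= 1, so that a p k^2 >= a p k > 1, a contradiction. *)
  pose k := (Num.bound (a * p)^-1).+1.
  have k1 : 1 <= (k%:R : R) by rewrite ler1n.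
  have kb : (a * p)^-1 < k%:R.
    apply: (lt_le_trans (archi_boundP _)); first by rewrite invr_ge0 ltW.
    by rewrite ler_nat.
  have k2 : 0 < 1 + a * k%:R ^+ 2.
    by rewrite ltr_pwDl// mulr_ge0 ?sqr_ge0// ltW.
  have := PN k; rewrite -[_^-1]mul1r ler_pdivlMr// leNgt => /negP; apply.
  have : 1 < a * p * k%:R by rewrite mulrC -ltr_pdivrMr// div1r.
  have : a * p * k%:R <= a * p * k%:R ^+ 2.
    by rewrite (ler_wpM2l (ltW ap))// expr2 ler_peMl// ler0n.
  have -> : p * (1 + a * k%:R ^+ 2) = p + a * p * k%:R ^+ 2 by ring.
  by move: p0; lra.
- move=> om no k _; apply: contrapT => nok; apply: no.
  have [c [co _ cle]] : exists c, [/\ c \in nbr o, true &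
      ((wt om (o, c))%:E + barrier_lim nbr (wt om) o c <= k%:R%:E)%E].
    apply: (@bigmin_barrier_lim _ _ _ _ _ predT); first exact: ltry.
    move=> n; rewrite leNgt; apply/negP => h; apply: nok; exists n => //.
    by move: h; rewrite {1}/rnbr eqxx.
  exists c => //; rewrite ltNge leye_eq; apply/negP => /eqP e.
  by move: cle; rewrite e addey.
Qed.

Lemma has_exit_root om v : has_exit nbr (wt om) o -> has_exit nbr (wt om) v.
Proof.
move=> ho; elim: (dep v) {-2}v (leqnn (dep v)) => [|n IH] {}v.
  have [->//|vo] := eqVneq v o; by rewrite (rt_dep rt vo).
have [->//|vo] := eqVneq v o; rewrite (rt_dep rt vo) ltnS => /IH h.
have vp : par v \in nbr v by rewrite /rnbr (negbTE vo) inE eqxx.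
apply: has_exit_adj h => //.
by rewrite -(rt_adj rt) (rt_sym rt) (rt_adj rt).
Qed.

Theorem rooted_wired_MSA_limit : wired_MSA_limit_exists adj P U.
Proof.
(* The limit is defined from the weights alone, before any exhaustion is given. Where there is no
   strict minimizer, [xget] returns the dummy value [v]. *)
exists (fun om v => (v, xget v [set y | strict_argmin o par ch (wt om) v y])).
move=> K exK v.
pose ties := [set om | exists2 y, y \in nbr v & exists2 z, z \in nbr v &
  y != z /\ (exit_cost o par ch (wt om) v y < +oo)%E /\
    exit_cost o par ch (wt om) v y = exit_cost o par ch (wt om) v z].
have nt : P.-negligible ties.
  apply: negligible_exists_seq => y yv; apply: negligible_exists_seq => z zv.
  have [->|yz] := eqVneq y z.
    by apply: negligibleS (negligible_set0 P) => om [].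
  by apply: negligibleS (exit_cost_tie yv zv yz) => om [].
apply: negligibleS (negligibleU root_no_exit nt) => om /=.
apply: contra_notP => /not_orP[/contrapT ho not].
have [y ymin] : exists y, strict_argmin o par ch (wt om) v y.
  apply: strict_argmin_exists; first exact: has_exit_root.
  move=> y z yv zv yz fin; apply/eqP => e; apply: not.
  by exists y => //; exists z.
case: xgetP => [x _ xm|/(_ y)//].
have [N HN] := MSA_strict_argmin rt xm exK.
by exists N => i Ni A /(HN i Ni).
Qed.

End AlmostSure.

(** * Rooting a tree and its hitting flow *)

Section TreeRoot.
Variables (V : countType) (nb : V -> seq V) (o : V).
Hypothesis tree : is_tree nb.
Local Notation adj := (gadj nb).

Let nb_uniq v : uniq (nb v). Proof. by case: tree => -[]. Qed.
Let adj_sym u v : adj u v = adj v u. Proof. by case: tree => -[_ + _] _ _; exact. Qed.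
Let adj_irr v : ~~ adj v v. Proof. by case: tree => -[_ _ +] _ _; exact. Qed.

Let ex_dist x : exists n, `[< exists p, [/\ path adj x p, last x p = o & size p = n] >].
Proof.
have [_ /(_ x o)[p [pp lp]] _] := tree.
by exists (size p); apply/asboolP; exists p.
Qed.

Definition tree_dep x := ex_minn (ex_dist x).

Lemma tree_dep_le x p : path adj x p -> last x p = o -> (tree_dep x <= size p)%N.
Proof.
move=> pp lp; rewrite /tree_dep; case: ex_minnP => m _; apply.
by apply/asboolP; exists p.
Qed.

Lemma tree_dep_path x : exists p, [/\ path adj x p, last x p = o & size p = tree_dep x].
Proof. by rewrite /tree_dep; case: ex_minnP => m /asboolP. Qed.

Lemma tree_dep0 : tree_dep o = 0%N.
Proof. by apply/eqP; rewrite -leqn0; exact: (@tree_dep_le o [::]). Qed.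

Lemma tree_dep_adj x y : adj x y -> (tree_dep x <= (tree_dep y).+1)%N.
Proof.
have [p [pp lp <-]] := tree_dep_path y => xy.
by apply: (@tree_dep_le x (y :: p)); rewrite //= xy.
Qed.

Lemma tree_dep_down x : x != o -> exists2 y, y \in nb x & tree_dep x = (tree_dep y).+1.
Proof.
move=> xo; have [[|y p] [pp lp sp]] := tree_dep_path x.
  by rewrite -lp eqxx in xo.
move: pp => /= /andP[xy pp]; exists y => //.
apply/eqP; rewrite eqn_leq tree_dep_adj// -sp /= ltnS.
exact: tree_dep_le.
Qed.

(** The first listed neighbour one step closer to [o]; at [o] the search fails and the default of
    [nth] gives [o] itself. *)
Definition tree_par x :=
  nth x (nb x) (find (fun y => tree_dep x == (tree_dep y).+1) (nb x)).

Lemma tree_parP x : x != o -> tree_par x \in nb x /\ tree_dep x = (tree_dep (tree_par x)).+1.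
Proof.
move=> /tree_dep_down[y yx e].
have h : has (fun y => tree_dep x == (tree_dep y).+1) (nb x).
  by apply/hasP; exists y => //; rewrite e.
split; first by rewrite mem_nth// -has_find.
by apply/eqP; exact: (nth_find x h).
Qed.

Lemma tree_descent y : exists p, [/\ path adj y p, last y p = o &
  all (fun u => tree_dep u < tree_dep y)%N p].
Proof.
elim: (tree_dep y) {-2}y (erefl (tree_dep y)) => [|n IH] {}y e.
  have [->|yo] := eqVneq y o; first by exists [::].
  by have [_] := tree_parP yo; rewrite e.
have [->|yo] := eqVneq y o; first by exists [::].
have [py ey] := tree_parP yo.
have [p [pp lp ap]] : exists p, [/\ path adj (tree_par y) p, last (tree_par y) p = o &
    all (fun u => tree_dep u < tree_dep (tree_par y))%N p].
  by apply: IH; move: ey; rewrite e => -[].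
exists (tree_par y :: p); split => //=; first by rewrite pp andbT.
rewrite ey ltnSn /=; apply: sub_all ap => u /= h; exact: ltnW.
Qed.

(** If [y] were a second neighbour not farther from the root, both it and the parent would descend
    to [o] without meeting [x]. Joining the two descents and closing up through [x] yields a cycle.
    This also excludes edges between vertices of equal depth. *)
Lemma tree_par_uniq x y : adj x y -> (tree_dep y <= tree_dep x)%N ->
  x != o /\ y = tree_par x.
Proof.
move=> xy yx.
have xo : x != o.
  apply/eqP => xo; move: yx; rewrite xo tree_dep0 leqn0 => /eqP dy.
  have [[|z p] [_ lp sp]] := tree_dep_path y; last by rewrite dy in sp.
  by move: xy; rewrite xo -lp /=; apply/negP/adj_irr.
split=> //; apply: contrapT => yz.
have [zx dz] := tree_parP xo; set z := tree_par x in yz zx dz.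
(* Adjacency in the graph with [x] deleted. *)
pose e := [rel a b | [&& adj a b, a != x & b != x]].
have esym : symmetric e by move=> a b /=; rewrite adj_sym; congr andb; rewrite andbC.
have avoid u : adj x u -> (tree_dep u <= tree_dep x)%N ->
    exists2 p, path e u p & last u p = o.
  move=> xu ux; have [p [pp lp ap]] := tree_descent u; exists p => //.
  have ux' : u != x by apply: contraTneq xu => ->; exact: adj_irr.
  have xp : x \notin p.
    by apply/negP => /(allP ap); rewrite ltnNge ux.
  elim: p u {lp ap xu ux} pp ux' xp => [//|v p IH] u /= /andP[uv pp] ux'.
  rewrite inE negb_or eq_sym => /andP[vx xp].
  by rewrite uv ux' vx /=; exact: IH.
have [p pp lp] := avoid y xy yx.
have zdx : (tree_dep z <= tree_dep x)%N by rewrite dz.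
have [q pq lq] := avoid z zx zdx.
have [r pr lr] : exists2 r, path e y r & last y r = z.
  exists (p ++ rev (belast z q)).
    rewrite cat_path pp lp -lq rev_path (eq_path (e' := e))//.
  rewrite last_cat lp; case: (q) lq => [|a t _] //=.
  by rewrite rev_cons last_rcons.
case: tree => _ _; apply; exists x.
move: lr; case/shortenP: pr => r' pr' ur' _ lr.
have xr' : x \notin r'.
  elim: r' (y) pr' {ur' lr} => [//|b t IH] a /= /andP[/and3P[_ _ bx] pt].
  by rewrite inE negb_or eq_sym bx /=; exact: IH pt.
have padj : path adj y r' by apply: sub_path pr' => a b /= /andP[].
exists (rcons (y :: r') x); split.
- by rewrite rcons_path /= lr padj andbT xy adj_sym.
- by rewrite last_rcons.
- rewrite size_rcons /= !ltnS; case: (r') lr => [|? ?] //=.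
- rewrite rcons_uniq ur' andbT inE negb_or xr' andbT.
  by apply: contraTneq xy => ->; exact: adj_irr.
Qed.

Definition tree_ch x := [seq y <- nb x | (y != o) && (tree_par y == x)].

Lemma tree_rooted : rooted_tree adj o tree_par tree_dep tree_ch.
Proof.
have chE x y : (y \in tree_ch x) = (y != o) && (tree_par y == x).
  rewrite mem_filter andb_idr// => /andP[yo /eqP <-].
  by rewrite -[_ \in _]/(adj _ _) adj_sym; have [] := tree_parP yo.
split.
- move=> x y; apply/idP/idP => [xy|].
    have [yx|xy'] := leqP (tree_dep y) (tree_dep x).
      have [xo ->] := tree_par_uniq xy yx.
      by rewrite /rnbr (negbTE xo) inE eqxx.
    have yx : adj y x by rewrite adj_sym.
    have [yo xE] := tree_par_uniq yx (ltnW xy').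
    have yc : y \in tree_ch x by rewrite chE yo -xE eqxx.
    by rewrite /rnbr; case: eqP => _ //; rewrite inE yc orbT.
  rewrite /rnbr; case: eqP => [_|/eqP xo]; first by rewrite mem_filter => /andP[].
  rewrite inE => /orP[/eqP->|]; first by have [] := tree_parP xo.
  by rewrite mem_filter => /andP[].
- exact: chE.
- by move=> x; rewrite filter_uniq.
- exact: tree_dep0.
- by move=> x /tree_parP[].
Qed.

End TreeRoot.

(** * The flow given by the gradient of the hitting probability *)

Section HittingFlow.
Variables (R : realType) (V : countType) (nb : V -> seq V) (o : V).
Variables (par : V -> V) (dep : V -> nat) (ch : V -> seq V).
Hypothesis nbu : forall v, uniq (nb v).
Hypothesis rt : rooted_tree (gadj nb) o par dep ch.
Local Notation nbr := (rnbr o par ch).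

Definition hit_by n x : R := \sum_(k < n.+1) hit_prob nb R o k x.

Let nb_perm x : perm_eq (nb x) (nbr x).
Proof.
apply: uniq_perm => //; first exact: (rnbr_uniq rt).
by move=> y; rewrite -(rt_adj rt).
Qed.

Lemma hit_by_root n : hit_by n o = 1.
Proof.
by rewrite /hit_by big_ord_recl /= eqxx big1 ?addr0// => i _ /=; rewrite eqxx.
Qed.

Lemma hit_byS n x : x != o ->
  hit_by n.+1 x = (size (nb x))%:R^-1 * \sum_(y <- nb x) hit_by n y.
Proof.
move=> xo; rewrite /hit_by big_ord_recl /= (negbTE xo) add0r.
by rewrite -mulr_sumr exchange_big.
Qed.

Lemma hit_prob_ge0 k x : 0 <= hit_prob nb R o k x.
Proof.
elim: k x => [|m IH] x /=; first exact: ler0n.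
by case: ifP => // _; rewrite mulr_ge0 ?invr_ge0 ?ler0n// sumr_ge0.
Qed.

Lemma hit_by_ge0 n x : 0 <= hit_by n x.
Proof. by apply: sumr_ge0 => k _; exact: hit_prob_ge0. Qed.

Lemma hit_by_leS n x : hit_by n x <= hit_by n.+1 x.
Proof. by rewrite /hit_by [leRHS]big_ord_recr lerDl; exact: hit_prob_ge0. Qed.

Lemma size_nb x : x != o -> size (nb x) = (size (ch x)).+1.
Proof. by move=> xo; rewrite (perm_size (nb_perm x)) /rnbr (negbTE xo). Qed.

(** One more step averages over the parent and the children of [x]; by induction no child exceeds
    [x], which does not exceed its parent, so the average is at most the value at the parent. *)
Lemma hit_by_par n x : x != o -> hit_by n x <= hit_by n (par x).
Proof.
elim: n x => [|n IH] x xo.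
  by rewrite {1}/hit_by big_ord1 /= (negbTE xo) hit_by_ge0.
apply: le_trans (hit_by_leS _ _).
rewrite hit_byS// (size_nb xo) (perm_big _ (nb_perm x)) /= /rnbr (negbTE xo) big_cons.
rewrite ler_pdivrMl ?ltr0n// mulrC -[(_.+1)%:R]natr1 mulrDr mulr1 [leRHS]addrC lerD2l.
apply: (@le_trans _ _ (\sum_(y <- ch x) hit_by n (par x))).
  rewrite big_seq [leRHS]big_seq; apply: ler_sum => y.
  rewrite (rt_ch rt) => /andP[yo /eqP py].
  by apply: le_trans (IH x xo); rewrite -py; exact: IH.
by rewrite big_const_seq count_predT iter_addr_0 mulr_natr.
Qed.

Lemma hit_by_le1 n x : hit_by n x <= 1.
Proof.
rewrite -(hit_by_root n); elim: (dep x) {-2}x (leqnn (dep x)) => [|m IH] {}x.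
  have [->//|xo] := eqVneq x o; by rewrite (rt_dep rt xo).
have [->//|xo] := eqVneq x o; rewrite (rt_dep rt xo) ltnS => /IH; apply: le_trans.
exact: hit_by_par.
Qed.

Definition hit x : R := limn (hit_by ^~ x).

Lemma hit_cvg x : hit_by ^~ x @ \oo --> hit x.
Proof.
apply: nondecreasing_is_cvgn.
  by apply/nondecreasing_seqP => n; exact: hit_by_leS.
by exists 1 => _ [n _ <-]; exact: hit_by_le1.
Qed.

Lemma hit_sum_cvg (r : seq V) :
  (fun n => \sum_(y <- r) hit_by n y) @ \oo --> \sum_(y <- r) hit y.
Proof.
elim: r => [|y r IH].
  under eq_fun do rewrite big_nil; rewrite big_nil; exact: cvg_cst.
under eq_fun do rewrite big_cons; rewrite big_cons.
by apply: cvgD => //; exact: hit_cvg.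
Qed.

Lemma hit_ge0 x : 0 <= hit x.
Proof.
by apply: limr_ge; [apply/cvg_ex; eexists; exact: hit_cvg|apply: nearW => n; exact: hit_by_ge0].
Qed.

Lemma hit_root : hit o = 1.
Proof.
rewrite /hit; under eq_fun do rewrite hit_by_root; exact: lim_cst.
Qed.

Lemma hit_par x : x != o -> hit x <= hit (par x).
Proof.
move=> xo; apply: ler_lim; [apply/cvg_ex; eexists; exact: hit_cvg..|].
by apply: nearW => n; exact: hit_by_par.
Qed.

(** Harmonicity away from the root, read as conservation of the flow. *)
Lemma hit_harmonic x : x != o ->
  \sum_(y <- ch x) (hit x - hit y) = hit (par x) - hit x.
Proof.
move=> xo.
have h : hit x = (size (nb x))%:R^-1 * \sum_(y <- nb x) hit y.
  have c1 : (fun n => hit_by n.+1 x) @ \oo --> hit x.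
    by have := @hit_cvg x; rewrite -(cvg_shiftS (hit_by ^~ x)).
  have c2 : (fun n => hit_by n.+1 x) @ \oo --> (size (nb x))%:R^-1 * \sum_(y <- nb x) hit y.
    under eq_fun do rewrite hit_byS//; apply: cvgM; [exact: cvg_cst|exact: hit_sum_cvg].
  exact: cvg_unique c1 c2.
have sz := size_nb xo.
have {h} : (size (ch x)).+1%:R * hit x = hit (par x) + \sum_(y <- ch x) hit y.
  rewrite {1}h sz mulrA divff ?pnatr_eq0// mul1r (perm_big _ (nb_perm x)) /=.
  by rewrite /rnbr (negbTE xo) big_cons.
rewrite sumrB big_const_seq count_predT iter_addr_0 -natr1 mulrDl mul1r mulr_natl.
by move=> e; lra.
Qed.

(** The flow out of the root is its degree times the escape probability, hence at least the degree
    times 1 - c. *)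
Lemma hit_root_flow (c : R) : nb o != [::] -> c < 1 ->
  (forall n, return_prob_by nb R o n <= c) -> 0 < \sum_(y <- ch o) (hit o - hit y).
Proof.
move=> nbo c1 hc.
have szo : 0 < (size (nb o))%:R :> R by rewrite ltr0n; case: (nb o) nbo.
have chE : \sum_(y <- ch o) (hit o - hit y) = \sum_(y <- nb o) (hit o - hit y).
  by rewrite [RHS](perm_big _ (nb_perm o)) /= /rnbr eqxx.
rewrite chE sumrB hit_root big_const_seq count_predT iter_addr_0 subr_gt0.
apply: (@le_lt_trans _ _ ((size (nb o))%:R * c)); last by rewrite gtr_pMr.
rewrite -(cvg_lim _ (@hit_sum_cvg (nb o)))//.
apply: limr_le; first by apply/cvg_ex; eexists; exact: hit_sum_cvg.
apply: nearW => n; rewrite -ler_pdivrMl//; apply: le_trans (hc n.+1).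
rewrite /return_prob_by -mulr_sumr ler_wpM2l ?invr_ge0 ?ler0n//.
by rewrite exchange_big.
Qed.

End HittingFlow.

(** * Subdivisions *)

Section Subdivision.
Variables (V : countType) (nb : V -> seq V) (l : V -> V -> nat) (M : nat).
Variables (o : V) (par : V -> V) (dep : V -> nat) (ch : V -> seq V).
Hypothesis rt : rooted_tree (gadj nb) o par dep ch.
Hypothesis lb : subdiv_lengths_bounded nb l M.
Local Notation W := (sdV nb l).
Local Notation root := (inl o : W).
Local Notation adjW := (sd_adj nb l).

Definition len c := l (par c) c.

Let par_nb c : c != o -> par c \in nb c.
Proof. by move=> co; rewrite -[_ \in _]/(gadj nb c (par c)) (rt_adjE rt) co eqxx. Qed.

Let nb_par c : c != o -> c \in nb (par c).
Proof.
by move=> co; rewrite -[_ \in _]/(gadj nb (par c) c) (rt_sym rt); exact: par_nb.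
Qed.

Let par_neq c : c != o -> c != par c.
Proof. by move=> co; apply/eqP => e; have := rt_dep rt co; rewrite -e; lia. Qed.

Let par_par c : c != o -> par c != o -> par (par c) != c.
Proof.
move=> co po; apply/eqP => e; have := rt_dep rt co; have := rt_dep rt po.
by rewrite e; lia.
Qed.

Lemma len_bounds c : c != o -> (0 < len c <= M)%N.
Proof. by move=> /nb_par /lb[h1 h2 _]; rewrite /len h1 h2. Qed.

Lemma len_sym c : c != o -> l c (par c) = len c.
Proof. by move=> /nb_par /lb[_ _]. Qed.

(* [site c i] is the vertex at distance [i] from [par c] on the path that
   replaces the edge {par c, c}; every vertex other than the root is [site c i]
   for a unique [c] and a unique [0 < i <= len c]. *)
Definition site (c : V) (i : nat) : W :=
  if i == 0%N then inl (par c) else if i == len c then inl c else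
  if insub (if (pickle (par c) < pickle c)%N then (par c, c, i)
            else (c, par c, (len c - i)%N)) is Some q then inr q else inl c.

Definition coord (x : W) : V * nat :=
  match x with
  | inl u => (u, len u)
  | inr q => let: (a, b, i) := val q in
             if (b != o) && (par b == a) then (b, i) else (a, (len a - i)%N)
  end.

Lemma site0 c : site c 0 = inl (par c). Proof. by []. Qed.

Lemma site_len c : c != o -> site c (len c) = inl c.
Proof. by move=> /len_bounds/andP[lc _]; rewrite /site gtn_eqF// eqxx. Qed.

(** The stored triple begins with the endpoint of smaller [pickle]. When this is the child,
    positions are counted from the other end, whence [len c - i]. *)
Lemma site_inr c i : c != o -> (0 < i < len c)%N ->
  exists q, [/\ site c i = inr q, coord (inr q) = (c, i) & 
    val q = (par c, c, i) \/ val q = (c, par c, (len c - i)%N)].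
Proof.
move=> co /andP[i0 il].
rewrite /site (gtn_eqF i0) (ltn_eqF il).
case: ltnP => pk.
  have h : subdiv_pred nb l (par c, c, i) by rewrite /subdiv_pred /= nb_par// pk i0 il.
  rewrite (insubT (subdiv_pred nb l) h); eexists; split; [by []| |by left].
  by rewrite /= co eqxx.
have h : subdiv_pred nb l (c, par c, (len c - i)%N).
  rewrite /subdiv_pred /= par_nb// subn_gt0 il len_sym// ltn_subrL i0 (ltn_trans i0 il).
  rewrite !andbT ltn_neqAle pk andbT.
  by apply: contra (par_neq co) => /eqP /(pcan_inj pickleK)/eqP.
rewrite (insubT (subdiv_pred nb l) h); eexists; split; [by []| |by right].
rewrite /=; case: ifP => [/andP[po pp]|_].
  by rewrite (negbTE (par_par co po)) in pp.
by rewrite subKn// ltnW.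
Qed.

Lemma coord_site c i : c != o -> (0 < i <= len c)%N -> coord (site c i) = (c, i).
Proof.
move=> co /andP[i0]; rewrite leq_eqVlt => /orP[/eqP->|il]; first by rewrite site_len.
have ci : (0 < i < len c)%N by rewrite i0.
by have [q [-> ->]] := site_inr co ci.
Qed.

Lemma site_neq_root c i : c != o -> (0 < i <= len c)%N -> site c i != root.
Proof.
move=> co ci; apply/eqP => e; have := coord_site co ci.
by rewrite e => -[oc _]; rewrite oc eqxx in co.
Qed.

Lemma inr_coord (q : {p | subdiv_pred nb l p}) : exists c i,
  [/\ c != o, (0 < i < len c)%N, coord (inr q) = (c, i), site c i = inr q &
   val q = (par c, c, i) \/ val q = (c, par c, (len c - i)%N)].
Proof.
have := valP q; case E: (val q) => [[a b] i]; rewrite /subdiv_pred /=.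
move=> /and4P[ab pk i0 il].
have : gadj nb a b by [].
rewrite (rt_adjE rt) => /orP[/andP[ao /eqP bE]|/andP[bo /eqP aE]].
  subst b; exists a, (len a - i)%N.
  rewrite len_sym// in il.
  have nb0 : (par a != o) && (par (par a) == a) = false.
    by apply/negP => /andP[po pp]; rewrite (negbTE (par_par ao po)) in pp.
  have bd : (0 < len a - i < len a)%N by rewrite subn_gt0 il ltn_subrL i0 (ltn_trans i0 il).
  split => //; rewrite ?subKn ?(ltnW il)//.
  - by rewrite /= E nb0.
  - move: bd => /andP[b1 b2]; rewrite /site (gtn_eqF b1) (ltn_eqF b2).
    by rewrite ltnNge (ltnW pk) /= subKn ?(ltnW il)// -E valK.
  - by right.
subst a; exists b, i; split => //.
- by rewrite i0.
- by rewrite /= E bo eqxx.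
- by rewrite /site (gtn_eqF i0) (ltn_eqF il) pk -E valK.
- by left.
Qed.

Lemma site_coord x : x != root ->
  [/\ (coord x).1 != o, (0 < (coord x).2 <= len (coord x).1)%N
    & site (coord x).1 (coord x).2 = x].
Proof.
case: x => [u uo|q _].
  have uo' : u != o by apply: contra uo => /eqP->.
  have /andP[l0 _] := len_bounds uo'.
  by rewrite /= l0 leqnn site_len.
have [c [i [co /andP[i0 il] -> sE _]]] := inr_coord q.
by split => //=; rewrite i0 ltnW.
Qed.

Definition sd_par (x : W) : W := site (coord x).1 (coord x).2.-1.

Definition sd_ch (x : W) : seq W :=
  match x with
  | inl u => [seq site c 1 | c <- ch u]
  | inr _ => [:: site (coord x).1 (coord x).2.+1]
  end.

(** [n] is fuel: with [dep u] steps this adds the lengths of the edges between [u] and the root, the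
    depth of [u] after subdivision. *)
Fixpoint height_rec n u := if n is n'.+1 then (height_rec n' (par u) + len u)%N else 0%N.

Definition height u := height_rec (dep u) u.

Definition sd_dep (x : W) : nat :=
  if x is inl u then height u else (height (par (coord x).1) + (coord x).2)%N.

Lemma height_par c : c != o -> height c = (height (par c) + len c)%N.
Proof. by move=> co; rewrite /height (rt_dep rt co). Qed.

Lemma sd_dep_site c i : c != o -> (i <= len c)%N ->
  sd_dep (site c i) = (height (par c) + i)%N.
Proof.
move=> co; case: i => [|i]; first by rewrite site0 addn0.
rewrite leq_eqVlt => /orP[/eqP->|il]; first by rewrite site_len//= height_par.
have ci : (0 < i.+1 < len c)%N by [].
by have [q [-> cE _]] := site_inr co ci; rewrite /sd_dep cE.
Qed.

Lemma sd_par_site c i : c != o -> (0 < i <= len c)%N -> sd_par (site c i) = site c i.-1.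
Proof. by move=> co ci; rewrite /sd_par coord_site. Qed.

Lemma sd_par_mem c i : c != o -> (0 < i <= len c)%N -> site c i \in sd_ch (site c i.-1).
Proof.
move=> co /andP[]; case: i => [//|[|i]] _ il.
  by rewrite site0 /=; apply/mapP; exists c; rewrite // (rt_ch rt) co eqxx.
have ci : (0 < i.+1 < len c)%N by [].
have [q [-> cE _]] := site_inr co ci.
by rewrite /sd_ch cE inE eqxx.
Qed.

Lemma sd_chE x y : (y \in sd_ch x) = (y != root) && (sd_par y == x).
Proof.
apply/idP/andP => [|[yo /eqP <-]]; last first.
  have [co ci yE] := site_coord yo.
  by rewrite -{1}yE; exact: sd_par_mem.
case: x => [u /mapP[c]|q].
  rewrite (rt_ch rt) => /andP[co /eqP pc] ->.
  have ci : (0 < 1 <= len c)%N by have /andP[-> _] := len_bounds co.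
  by rewrite site_neq_root// sd_par_site// site0 pc.
have [c [i [co /andP[i0 il] cE sE _]]] := inr_coord q.
rewrite /sd_ch cE inE => /eqP ->.
by rewrite site_neq_root// sd_par_site//= sE.
Qed.

Lemma sd_adj_sym x y : adjW x y = adjW y x.
Proof.
case: x y => [u|q] [v|q'] //=.
  have [uv|uv] := boolP (v \in nb u).
    have vu : u \in nb v by rewrite -[_ \in _]/(gadj nb v u) (rt_sym rt).
    by have [_ _ ->] := lb uv; rewrite vu.
  have -> // : (u \in nb v) = false.
  by apply/negP => vu; move/negP: uv; apply; rewrite -[_ \in _]/(gadj nb u v) (rt_sym rt).
case: (val q) => [[a b] i]; case: (val q') => [[c e] j].
by rewrite (eq_sym a) (eq_sym b) orbC.
Qed.

Lemma sd_adj_par x : x != root -> adjW x (sd_par x).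
Proof.
move=> xo; have [] := site_coord xo; rewrite /sd_par.
case: (coord x) => c [//|j] /= co jl <-.
have [jE|jE] := eqVneq j.+1 (len c).
  rewrite jE site_len//; case: j jE {jl} => [|j] jE.
    by rewrite site0 /= par_nb// len_sym// -jE.
  have ci : (0 < j.+1 < len c)%N by rewrite -jE /=.
  have [q [-> _ [vq|vq]]] := site_inr co ci.
    by rewrite /sd_adj vq -/(len c) -jE !eqxx orbT.
  by rewrite /sd_adj vq -jE subSnn !eqxx.
have {jE jl} jl : (0 < j.+1 < len c)%N by rewrite /= ltn_neqAle jE.
have [q [-> _ vq]] := site_inr co jl.
case: j jl vq => [|j] jl vq.
  rewrite site0; case: vq => vq; rewrite /sd_adj vq ?eqxx//.
  by rewrite len_sym// subn1 prednK ?eqxx ?orbT// ltnW.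
have ji : (0 < j.+1 < len c)%N by rewrite /= ltnW.
have [q' [-> _ vq']] := site_inr co ji.
have pc := par_neq co.
move: jl ji => /= jl ji.
(* Both triples come from the same edge, and the order of the codes leaves only one way of storing
   it. *)
have same : (val q = (par c, c, j.+2) /\ val q' = (par c, c, j.+1)) \/
    (val q = (c, par c, (len c - j.+2)%N) /\ val q' = (c, par c, (len c - j.+1)%N)).
  have lt3 (p : {p | subdiv_pred nb l p}) a b k : val p = (a, b, k) ->
      (pickle a < pickle b)%N.
    by move=> pE; have := valP p; rewrite pE => /and4P[].
  case: vq vq' => [vq [vq'|vq']|vq [vq'|vq']]; [by left| | |by right].
    by have := ltn_trans (lt3 _ _ _ _ vq) (lt3 _ _ _ _ vq'); rewrite ltnn.
  by have := ltn_trans (lt3 _ _ _ _ vq) (lt3 _ _ _ _ vq'); rewrite ltnn.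
case: same => -[vE vE']; rewrite /sd_adj vE vE' !eqxx //=.
by apply/orP; right; rewrite subnSK.
Qed.

Lemma sd_adj_cases x y : adjW x y ->
  (x != root /\ y = sd_par x) \/ (y != root /\ x = sd_par y).
Proof.
have lp c : c != o -> (0 < len c)%N by move=> /len_bounds/andP[].
have half u q : adjW (inl u) (inr q) -> (inl u != root /\ inr q = sd_par (inl u)) \/
    ((inr q : W) != root /\ inl u = sd_par (inr q)).
  have [c [i [co /andP[i0 il] cE sE vE]]] := inr_coord q.
  have up : i = 1%N -> u = par c -> (inl u : W) = sd_par (inr q).
    by move=> i1 ->; rewrite /sd_par cE /= i1.
  have down : i.+1 = len c -> u = c -> inl u != root /\ inr q = sd_par (inl u).
    move=> i1 uc; subst u; split; first by apply: contra co => /eqP[->].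
    by rewrite /sd_par /= -i1 /= sE.
  case: vE => vE; rewrite /sd_adj vE => /orP[/andP[/eqP uE /eqP iE]|/andP[/eqP uE /eqP iE]].
  - by right; split => //; exact: up iE uE.
  - by left; exact: down iE uE.
  - by left; apply: down => //; lia.
  - by right; split => //; apply: up => //; move: iE; rewrite len_sym//; lia.
case: x y => [u|q] [v|q'].
- move=> /andP[uv /eqP l1]; have : gadj nb u v by [].
  rewrite (rt_adjE rt) => /orP[/andP[uo /eqP vE]|/andP[vo /eqP uE]].
    left; split; first by apply: contra uo => /eqP[->].
    have lu : len u = 1%N by rewrite -len_sym// -vE l1.
    by rewrite /sd_par /= lu vE.
  right; split; first by apply: contra vo => /eqP[->].
  have lv : len v = 1%N by rewrite /len uE.
  by rewrite /sd_par /= lv -uE.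
- exact: half.
- by rewrite sd_adj_sym => /half[]; [right|left].
- have [c [i [co /andP[i0 il] cE sE vE]]] := inr_coord q.
  have [c' [i' [co' /andP[i0' il'] cE' sE' vE']]] := inr_coord q'.
  have step : c = c' -> i = i'.+1 \/ i' = i.+1 ->
    ((inr q : W) != root /\ inr q' = sd_par (inr q)) \/
    ((inr q' : W) != root /\ inr q = sd_par (inr q')).
    move=> cc [ii|ii]; [left|right]; split => //.
      by rewrite /sd_par cE /= ii /= cc sE'.
    by rewrite /sd_par cE' /= ii /= -cc sE.
  case: vE => vE; case: vE' => vE'; rewrite /sd_adj vE vE' => /and3P[/eqP e1 /eqP e2 /orP[]/eqP e3];
    try (by apply: step => //; lia).
  (* In the four cases of mixed orientation, [c] and [c'] would be parents of each other. *)
  + by have := par_par co'; rewrite -e2 e1 eqxx => /(_ co).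
  + by have := par_par co'; rewrite -e2 e1 eqxx => /(_ co).
  + by have := par_par co'; rewrite -e1 e2 eqxx => /(_ co).
  + by have := par_par co'; rewrite -e1 e2 eqxx => /(_ co).
  + by apply: step => //; rewrite e1 in e3 il; clear -e3 il il'; lia.
  + by apply: step => //; rewrite e1 in e3 il; clear -e3 il il'; lia.
Qed.

Lemma sd_rooted : rooted_tree adjW root sd_par sd_dep sd_ch.
Proof.
split.
- move=> x y; have -> : (y \in rnbr root sd_par sd_ch x) =
      ((x != root) && (y == sd_par x)) || ((y != root) && (sd_par y == x)).
    rewrite /rnbr; have [->|xo] := eqVneq x root; first by rewrite -sd_chE.
    by rewrite inE sd_chE.
  apply/idP/orP => [/sd_adj_cases[[xo ->]|[yo ->]]|[/andP[xo /eqP->]|/andP[yo /eqP<-]]].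
  + by left; rewrite xo eqxx.
  + by right; rewrite yo eqxx.
  + exact: sd_adj_par.
  + by rewrite sd_adj_sym; exact: sd_adj_par.
- exact: sd_chE.
- move=> [u|q] //=; rewrite map_inj_in_uniq; first exact: (rt_uniq rt).
  move=> c c'; rewrite !(rt_ch rt) => /andP[co _] /andP[co' _] e.
  have l1 z : z != o -> (0 < 1 <= len z)%N by move=> /len_bounds/andP[->].
  by have := coord_site co (l1 _ co); rewrite e coord_site ?l1// => -[].
- by rewrite /= /height (rt_dep0 rt).
- move=> x xo; have [co /andP[i0 il] xE] := site_coord xo.
  rewrite -{1}xE sd_dep_site// /sd_par sd_dep_site//; last exact: leq_trans (leq_pred _) il.
  by rewrite -addnS prednK.
Qed.

Variables (R : realType) (F : V -> R).
Hypothesis F0 : forall v, 0 < F v.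
Hypothesis Fpar : forall v, v != o -> F v <= F (par v).
Hypothesis Fharm : forall v, v != o ->
  \sum_(y <- ch v) (F v - F y) = F (par v) - F v.
Hypothesis Froot : 0 < \sum_(y <- ch o) (F o - F y).

Definition sd_flow (x : W) : R :=
  if x == root then 0 else F (par (coord x).1) - F (coord x).1.

Definition sd_pot (x : W) : R :=
  if x == root then F o else let: (c, i) := coord x in
  F (par c) - i%:R / (len c)%:R * (F (par c) - F c).

Lemma sd_flow_site c i : c != o -> (0 < i <= len c)%N ->
  sd_flow (site c i) = F (par c) - F c.
Proof.
by move=> co ci; rewrite /sd_flow (negbTE (site_neq_root co ci)) coord_site.
Qed.

Lemma sd_pot_inl u : sd_pot (inl u) = F u.
Proof.
rewrite /sd_pot; case: eqP => [[->]//|/eqP uo] /=.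
have uo' : u != o by apply: contra uo => /eqP->.
have /andP[l0 _] := len_bounds uo'.
by rewrite divff ?pnatr_eq0 -?lt0n// mul1r opprB addrCA subrr addr0.
Qed.

Lemma sd_pot_site c i : c != o -> (i <= len c)%N ->
  sd_pot (site c i) = F (par c) - i%:R / (len c)%:R * (F (par c) - F c).
Proof.
move=> co; case: i => [|i] il; first by rewrite site0 sd_pot_inl !mul0r subr0.
by rewrite /sd_pot (negbTE (site_neq_root co _))// coord_site.
Qed.

Lemma sd_flow_ge0 x : 0 <= sd_flow x.
Proof.
rewrite /sd_flow; case: eqP => // /eqP xo; have [co _ _] := site_coord xo.
by rewrite subr_ge0 Fpar.
Qed.

Lemma sd_flow_inl u : \sum_(y <- sd_ch (inl u)) sd_flow y = \sum_(c <- ch u) (F u - F c).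
Proof.
rewrite big_map; apply: eq_big_seq => c; rewrite (rt_ch rt) => /andP[co /eqP pc].
by rewrite sd_flow_site// ?pc//; have /andP[-> _] := len_bounds co.
Qed.

Lemma sd_flow_conserved x : x != root -> \sum_(y <- sd_ch x) sd_flow y = sd_flow x.
Proof.
case: x => [u uo|q _].
  have uo' : u != o by apply: contra uo => /eqP->.
  by rewrite sd_flow_inl Fharm// /sd_flow (negbTE uo).
have [c [i [co /andP[i0 il] cE sE _]]] := inr_coord q.
have -> : sd_ch (inr q) = [:: site c i.+1] by rewrite /sd_ch cE.
by rewrite big_seq1 -sE !sd_flow_site// i0 ltnW.
Qed.

Lemma sd_pot_gt0 x : 0 < sd_pot x.
Proof.
have [->|xo] := eqVneq x root; first by rewrite sd_pot_inl.
have [co /andP[i0 il] <-] := site_coord xo.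
rewrite sd_pot_site//; set c := (coord x).1 in co il *; set i := (coord x).2 in i0 il *.
have l0 : 0 < (len c)%:R :> R by rewrite ltr0n (leq_trans i0 il).
have t1 : i%:R / (len c)%:R <= 1 :> R by rewrite ler_pdivrMr// mul1r ler_nat.
have := ler_wpM2r (_ : 0 <= F (par c) - F c) t1.
by rewrite subr_ge0 Fpar// mul1r => /(_ isT); have := F0 c; lra.
Qed.

(** Linear interpolation spreads the potential drop of an edge evenly over its [len c] pieces while
    each piece carries the full flow, so the ratio is the length, which is bounded. Taking [M.+1]
    keeps the constant positive for every [M]. *)
Lemma sd_flow_pot x : x != root ->
  sd_flow x <= M.+1%:R * (sd_pot (sd_par x) - sd_pot x).
Proof.
move=> xo; have [co /andP[i0 il] <-] := site_coord xo.
set c := (coord x).1 in co il *; set i := (coord x).2 in i0 il *.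
rewrite sd_flow_site ?i0// sd_par_site ?i0// !sd_pot_site//; last exact: leq_trans (leq_pred _) il.
have /andP[_ lM] := len_bounds co.
have l0 : 0 < (len c)%:R :> R by rewrite ltr0n (leq_trans i0 il).
have -> : F (par c) - i.-1%:R / (len c)%:R * (F (par c) - F c) -
    (F (par c) - i%:R / (len c)%:R * (F (par c) - F c)) =
    (F (par c) - F c) / (len c)%:R.
  by rewrite -{2}(prednK i0) -natr1; field; rewrite gt_eqF.
rewrite mulrA ler_pdivlMr// mulrC ler_wpM2r ?subr_ge0 ?Fpar// ler_nat.
exact: leqW.
Qed.

End Subdivision.

Theorem mainTheorem1 (R : realType) (V : countType) (nb : V -> seq V)
    (l : V -> V -> nat) (M : nat)
    (d : measure_display) (Omega : measurableType d) (P : probability Omega R)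
    (U : sdV nb l * sdV nb l -> Omega -> R) :
  is_tree nb -> infinite_vertices V -> no_degree_two nb -> srw_transient nb R ->
  subdiv_lengths_bounded nb l M ->
  iid_exp1_weights (sd_adj nb l) P U ->
  wired_MSA_limit_exists (sd_adj nb l) P U.
Proof.
move=> tree inf _ trans lb iid.
have [r _] := inf [::].
have nbo : nb r != [::].
  have [v vo] := inf [:: r]; have [_ /(_ r v)[p [pp lp]] _] := tree.
  case: p pp lp => [_ /= ov|y p /andP[oy _] _]; first by rewrite ov inE eqxx in vo.
  by apply: contraTneq oy => e; rewrite /gadj e.
have nbu : forall v, uniq (nb v) by case: tree => -[].
have rt := tree_rooted r tree.
(* Transience enters here, to make the flow leaving the root positive. *)
have [c [c1 hc]] := trans r.
have flow := hit_root_flow nbu rt nbo c1 hc.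
(* Shifting the potential by 1 makes it positive without changing the flow. *)
pose F v : R := hit R nb r v + 1.
have gradF u v : F u - F v = hit R nb r u - hit R nb r v by rewrite /F; ring.
have F0 v : 0 < F v by rewrite ltr_wpDl// (hit_ge0 R nbu rt).
have Fpar v : v != r -> F v <= F (tree_par r tree v).
  by move=> vo; rewrite lerD2r (hit_par R nbu rt).
have Fharm v : v != r -> \sum_(y <- tree_ch r tree v) (F v - F y) =
    F (tree_par r tree v) - F v.
  move=> vo; rewrite gradF -(hit_harmonic R nbu rt vo).
  by apply: eq_bigr => y _; rewrite gradF.
have Froot : 0 < \sum_(y <- tree_ch r tree r) (F r - F y).
  by under eq_bigr do rewrite gradF.
apply: (rooted_wired_MSA_limit (sd_rooted rt lb) iid (th := sd_flow r _ F)
  (F := sd_pot r _ F) (M := M.+1%:R)).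
- by rewrite ltr0n.
- exact: (sd_flow_ge0 rt lb Fpar).
- exact: (sd_flow_conserved rt lb Fharm).
- by rewrite (sd_flow_inl rt lb).
- exact: (sd_pot_gt0 rt lb F0 Fpar).
- exact: (sd_flow_pot rt lb Fpar).
Qed.
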